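(* Let $G^\sigma$ be an oriented graph whose underlying graph $G$ is a simple connected graph on $n$ vertices. Then $$sr(G^\sigma)+2\alpha(G)\geqslant 2n-2d(G).$$ Equality holds if and only if all of the following hold: (i) the cycles (if any) of $G$ are pairwise vertex-disjoint; (ii) each cycle of $G^\sigma$ is either odd or evenly-oriented; (iii) $\alpha(T_G)=\alpha(\Gamma_G)+d(G)$.
   Context: An oriented graph $G^\sigma$ is obtained from a simple graph $G$ (its underlying graph) by assigning a direction to each edge. Its skew-adjacency matrix $S(G^\sigma)=[s_{x,y}]$ has $s_{x,y}=1$ if there is an arc from $x$ to $y$, $s_{x,y}=-1$ if there is an arc from $y$ to $x$, and $0$ otherwise; the skew-rank $sr(G^\sigma)$ is the rank of $S(G^\sigma)$. $\alpha(G)$ is the independence number of $G$. $d(G)=|E_G|-|V_G|+\omega(G)$, where $\omega(G)$ is the number of connected components. For an even cycle $C_k=v_1v_2\cdots v_kv_1$ in $G^\sigma$, its sign is the sign of $s_{v_1,v_2}s_{v_2,v_3}\cdots s_{v_{k-1},v_k}s_{v_k,v_1}$; the cycle is evenly-oriented if this sign is positive and oddly-oriented if negative. When the cycles of $G$ are pairwise vertex-disjoint, $T_G$ is the acyclic graph obtained from $G$ by contracting each cycle to a single vertex, and $\Gamma_G$ is the graph obtained from $G$ by deleting all vertices lying on cycles together with their incident edges (equivalently, $T_G$ minus the vertices corresponding to the contracted cycles). *)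

(* Defs.v *)
From mathcomp Require Import all_boot all_order all_algebra.
Set Implicit Arguments. Unset Strict Implicit. Unset Printing Implicit Defensive.
Import Order.TTheory GRing.Theory Num.Theory.
Local Open Scope ring_scope.

Section Graphs.
Variable T : finType.

Definition oriented (arc : rel T) : Prop :=
  forall x y, arc x y -> ~~ arc y x.

Definition underlying (arc : rel T) : rel T := fun x y => arc x y || arc y x.

Definition skew_entry (arc : rel T) (x y : T) : int :=
  if arc x y then 1 else if arc y x then (-1) else 0.

Definition independent (e : rel T) (S : {set T}) : bool :=
  [forall x in S, forall y in S, ~~ e x y].

Definition indep_num (V : {set T}) (e : rel T) : nat :=
  \max_(S : {set T} | (S \subset V) && independent e S) #|S|.

Definition num_edges (e : rel T) : nat :=
  #|[set p : T * T | (enum_rank p.1 < enum_rank p.2)%N && e p.1 p.2]|.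

Definition num_comp (e : rel T) : nat := n_comp (connect e) (fun _ : T => true).

Definition dimcyc (e : rel T) : int :=
  (num_edges e)%:Z - (#|T|)%:Z + (num_comp e)%:Z.

Definition is_cycle (e : rel T) (c : seq T) : bool :=
  [&& (2 < size c)%N, uniq c & cycle e c].

(* The (undirected) edge set of a cycle, used to identify two sequences
   representing the same cycle (subgraph). *)
Definition cyc_edge (c : seq T) (x y : T) : bool :=
  (x \in c) && (y \in c) && ((next c x == y) || (next c y == x)).

Definition cycles_vertex_disjoint (e : rel T) : Prop :=
  forall c1 c2, is_cycle e c1 -> is_cycle e c2 ->
    [disjoint c1 & c2] \/ (forall x y, cyc_edge c1 x y = cyc_edge c2 x y).

Definition cycle_sign (arc : rel T) (c : seq T) : int :=
  \prod_(p <- zip c (rot 1 c)) skew_entry arc p.1 p.2.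

Definition cycles_odd_or_evenly_oriented (arc : rel T) : Prop :=
  forall c, is_cycle (underlying arc) c -> odd (size c) \/ 0 < cycle_sign arc c.

(* x and y lie on a common cycle (cycles have at most #|T| vertices). *)
Definition on_common_cycle (e : rel T) (x y : T) : bool :=
  [exists k : 'I_#|T|.+1, [exists t : k.-tuple T,
     [&& is_cycle e t, x \in t & y \in t]]].

Definition on_cycle (e : rel T) (x : T) : bool := on_common_cycle e x x.

Definition Gamma_vertices (e : rel T) : {set T} := [set x | ~~ on_cycle e x].

(* T_G: contract each cycle to a single vertex (meaningful when the cycles
   are pairwise vertex-disjoint).  Vertices are the classes
   {x} (x not on a cycle) or V(C) (C a cycle); two distinct classes are
   adjacent iff some vertex of one is adjacent in G to some vertex of the other. *)
Definition contr_class (e : rel T) (x : T) : {set T} :=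
  [set y | (y == x) || on_common_cycle e x y].

Definition TG_vertices (e : rel T) : {set {set T}} :=
  [set contr_class e x | x : T].

Definition TG_adj (e : rel T) : rel {set T} :=
  fun A B => (A != B) && [exists x in A, exists y in B, e x y].

End Graphs.

Definition skew_adj (n : nat) (arc : rel 'I_n) : 'M[rat]_n :=
  \matrix_(i < n, j < n) ((skew_entry arc i j)%:~R : rat).

Definition skew_rank (n : nat) (arc : rel 'I_n) : nat := \rank (skew_adj arc).

(* Main.v *)
Require Import Defs.
From mathcomp Require Import all_boot all_order all_algebra.
From mathcomp Require Import zify ring.
Set Implicit Arguments. Unset Strict Implicit. Unset Printing Implicit Defensive.

(** For a vertex set [V] let [r], [alpha], [d] denote the skew-rank, independence
    number and cyclomatic number of the subgraph induced by [V], and call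
    [r + 2 alpha + 2 d - 2 |V|] its defect.  Deleting a vertex [x] lowers [d] by
    the excess of [x], the number of its neighbours minus the number of components
    of [V - x] meeting them; it is positive exactly when [x] lies on a cycle.
    Hence deleting a vertex of a cycle does not increase the defect, while removing
    an isolated vertex, or a pendant vertex with its neighbour in a forest, preserves
    it: the defect is nonnegative.

    If the defect vanishes, every excess is at most 1, which means that the cycles
    are disjoint, and the graph has an isolated vertex, a pendant vertex, a cycle
    component or a pendant cycle.  In the last case let [b] be the attaching vertex
    and [y] its neighbour outside the cycle.  An alternating vector along the cycle
    puts the unit vector at [b] in the row space when the cycle is oddly-oriented
    (contradicting r(V) = r(V - b)), and the unit vector at [y] otherwise; then
    r(V) >= r(V - y) + 2, so [V - y] has defect zero and the same independence number.
    Comparing with [V - b], alpha(Gamma) = alpha(Gamma - y).  Conversely, under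
    (i)-(iii) a neighbour of a cycle off the cycles may be deleted without changing
    alpha, until the cycles are components, which carry kernel vectors.

    Condition (iii) is used in the form: adjacent cycle vertices share a cycle, and
    some maximum independent set of Gamma has no neighbour on a cycle; this is
    equivalent because [d] counts the cycles when they are disjoint. *)

(** * Induced subgraphs, cycles and the cyclomatic number *)

Section Graph.
Variables (T : finType) (e : rel T).
Hypotheses (e_sym : symmetric e) (e_irr : irreflexive e).
Implicit Types (V A B : {set T}) (x y : T) (c : seq T).

Definition induced V : rel T := fun x y => [&& x \in V, y \in V & e x y].
Definition nbrs V x := [set y in V | e x y].
Definition component V x := [set y | connect (induced V) x y].

Lemma inducedE V x y : induced V x y = [&& x \in V, y \in V & e x y].
Proof. by []. Qed.

Lemma induced_sym V : symmetric (induced V).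
Proof. by move=> x y; rewrite inducedE /= e_sym andbCA. Qed.

Lemma conn_sym V x y : connect (induced V) x y = connect (induced V) y x.
Proof. exact: (sym_connect_sym (@induced_sym V)). Qed.

Lemma conn_mono A B x y :
  A \subset B -> connect (induced A) x y -> connect (induced B) x y.
Proof.
move=> sAB; apply: connect_sub => u v /and3P[uA vA uv]; apply: connect1.
by rewrite inducedE !(subsetP sAB).
Qed.

Lemma conn_in V x y : connect (induced V) x y -> x \in V -> y \in V.
Proof.
case/connectP=> p; elim: p x => [|z p IH] x /= ; first by move=> _ ->.
by case/andP=> /and3P[_ zV _] pth Ey _; apply: IH Ey zV.
Qed.

Lemma nbrsP V x y : reflect (y \in V /\ e x y) (y \in nbrs V x).
Proof. by rewrite inE; apply: andP. Qed.

Lemma nbrs_neq V x y : y \in nbrs V x -> y != x.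
Proof. by rewrite inE => /andP[_]; apply: contraTneq => ->; rewrite e_irr. Qed.

Lemma path_avoid V a x p :
  path (induced V) x p -> a \notin x :: p -> path (induced (V :\ a)) x p.
Proof.
move=> pth ap; have := @sub_in_path T (fun z => z != a) (induced V) (induced (V :\ a)).
apply=> //.
  move=> u v ua va /and3P[uV vV uv].
  by rewrite inducedE !in_setD1 uV vV uv (ua : u != a) (va : v != a).
by apply/allP => z; apply: contraTneq => ->.
Qed.

(** A path shortened to have no repeated vertex never returns to [x], so its tail runs in
    [V :\ x]. *)
Lemma conn_first V x v : connect (induced V) x v -> v != x ->
  exists2 y, y \in nbrs V x & connect (induced (V :\ x)) y v.
Proof.
case/connectP=> p0 pth0 ->; case/shortenP: pth0 => -[|y p] /=; first by rewrite eqxx.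
case/andP=> /and3P[xV yV xy] pth /andP[xp _] _ _; exists y; first by rewrite inE yV.
by apply/connectP; exists p => //; apply: path_avoid.
Qed.

(** Every vertex of the path is joined to [w] inside [V :\ v], so the path cannot meet [a]. *)
Lemma conn_avoid V v a w z : connect (induced (V :\ v)) w z ->
  ~~ connect (induced (V :\ v)) w a -> connect (induced (V :\ a)) w z.
Proof.
case/connectP=> p pth -> wa; apply/connectP; exists p => //.
apply: path_avoid; first by apply: sub_path pth => s t /and3P[]; rewrite !inE =>
  /andP[_ sV] /andP[_ tV] st; rewrite inducedE sV tV.
by apply: contra wa => /(path_connect pth).
Qed.

Lemma prev_head x p : x \notin p -> prev (x :: p) x = last x p.
Proof.
rewrite /=; suff H z : x \notin p -> prev_at x x z p = last z p by exact: H.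
elim: p z => [|y p IH] z /=; first by rewrite eqxx.
by rewrite inE negb_or => /andP[/negPf -> /IH ->].
Qed.

Lemma next_head x y p : next [:: x, y & p] x = y.
Proof. by rewrite /= eqxx. Qed.

Definition cyc V c := is_cycle (induced V) c.

Lemma cycE V c : cyc V c = [&& 2 < size c, uniq c & cycle (induced V) c].
Proof. by []. Qed.

Lemma cyc_uniq V c : cyc V c -> uniq c. Proof. by case/and3P. Qed.

Lemma cyc_mono A B c : A \subset B -> cyc A c -> cyc B c.
Proof.
move=> sAB /and3P[s u cy]; rewrite cycE s u /=.
apply: (sub_in_cycle (P := predT)) cy => [x y _ _|]; last exact: all_predT.
by case/and3P=> xA yA xy; rewrite inducedE (subsetP sAB _ xA) (subsetP sAB _ yA).
Qed.

Lemma cyc_rot V c i : cyc V (rot i c) = cyc V c.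
Proof. by rewrite cycE size_rot rot_uniq rot_cycle. Qed.

Lemma cyc_sub V c x : cyc V c -> x \in c -> x \in V.
Proof. by case/and3P=> _ _ cy /(next_cycle cy) /and3P[]. Qed.

Lemma cyc_del V c x : x \notin c -> cyc V c -> cyc (V :\ x) c.
Proof.
move=> xc /and3P[s u cy]; rewrite cycE s u /=.
apply: (sub_in_cycle (P := fun z => z != x)) cy => [a b ax bx|].
  by case/and3P=> aA bA ab; rewrite inducedE !in_setD1 (ax : a != x) (bx : b != x) aA bA.
by apply/allP => z; apply: contraTneq => ->.
Qed.

Lemma cyc_delE V c x : cyc (V :\ x) c = (x \notin c) && cyc V c.
Proof.
apply/idP/andP => [cy|[]]; last exact: cyc_del.
split; last by apply: cyc_mono cy; apply: subsetDl.
by apply/negP => /(cyc_sub cy); rewrite !inE eqxx.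
Qed.

(** A cycle can be rotated to start at any of its vertices; [next] and [prev] at that vertex then
    compute. *)
Lemma cyc_head V c x : cyc V c -> x \in c ->
  exists a b p, let c' := [:: x, a, b & p] in
   [/\ cyc V c', c =i c', next c =1 next c', prev c =1 prev c' & exists i, rot i c = c'].
Proof.
move=> cy xc; have [i c' E] := rot_to xc.
have u := cyc_uniq cy.
have cy' : cyc V (x :: c') by rewrite -E cyc_rot.
have s : 2 < size (x :: c') by case/and3P: cy'.
case: c' s E cy' => [|a [|b p]] //= _ E cy'; exists a, b, p; split=> //.
- by move=> z; rewrite -E mem_rot.
- by move=> z; rewrite -E next_rot.
- by move=> z; rewrite -E prev_rot.
- by exists i.
Qed.

Lemma cyc_next V c x : cyc V c -> x \in c -> next c x \in nbrs V x.
Proof. by case/and3P=> _ _ cy /(next_cycle cy) /and3P[_ zV ez]; rewrite inE zV. Qed.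

Lemma cyc_prev V c x : cyc V c -> x \in c -> prev c x \in nbrs V x.
Proof.
by case/and3P=> _ _ cy /(prev_cycle cy) /and3P[zV _ ez]; rewrite inE zV e_sym.
Qed.

Lemma cyc_next_neq_prev V c x : cyc V c -> x \in c -> next c x != prev c x.
Proof.
move=> cy xc; have [a [b [p [cy' _ -> -> _]]]] := cyc_head cy xc.
have := cyc_uniq cy'; rewrite !cons_uniq => /and3P[xn an _].
rewrite next_head prev_head //; apply: contraNneq an => ->; exact: (mem_last b p).
Qed.

Lemma cyc_conn V c v u w : cyc V c -> v \in c -> u \in c -> w \in c ->
  u != v -> w != v -> connect (induced (V :\ v)) u w.
Proof.
move=> cy vc; have [a [b [p [cy' E _ _ _]]]] := cyc_head cy vc.
rewrite !E; case/and3P: cy' => _; rewrite cons_uniq => /andP[vp _] /=.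
case/andP=> _; set q := b :: p in vp *.
move=> pth; have pq : path (induced (V :\ v)) a q.
  apply: path_avoid vp.
  by move: (pth : path (induced V) a (rcons q v)); rewrite rcons_path => /andP[].
have H z : z \in [:: v, a & q] -> z != v -> connect (induced (V :\ v)) a z.
  by rewrite inE => /orP[->//|za _]; apply: (path_connect pq).
by move=> uq wq uv wv; apply: connect_trans (H _ wq wv); rewrite conn_sym H.
Qed.

Lemma cyc_connect V c u w : cyc V c -> u \in c -> w \in c -> connect (induced V) u w.
Proof.
move=> cy uc; have [a [b [p [cy' -> _ _ _]]]] := cyc_head cy uc.
case/and3P: cy' => _ _; rewrite /cycle rcons_path => /andP[pth _] wp.
exact: (path_connect pth).
Qed.

(** A simple path from [a] to [b] avoiding [x] closes up through [x], and [a != b] makes the length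
    at least 3. Recording [next] and [prev] at [x] allows comparison with other cycles through
    [x]. *)
Lemma conn_cyc V x a b : a \in nbrs V x -> b \in nbrs V x -> a != b ->
  connect (induced (V :\ x)) a b ->
  x \in V -> exists c, [/\ cyc V c, x \in c, next c x = a & prev c x = b].
Proof.
move=> ax bx ab /connectP[p0 pth0 Eb] xV.
case/shortenP: pth0 Eb => p pth u _ Eb.
have xp : x \notin a :: p.
  have Hin z : z \in a :: p -> z != x.
    move/(path_connect pth) => /conn_in H; suff: z \in V :\ x by rewrite !inE => /andP[].
    by apply: H; rewrite !inE (nbrs_neq ax); case/nbrsP: ax.
  by apply/negP => /Hin; rewrite eqxx.
exists [:: x, a & p]; split; rewrite ?mem_head ?next_head ?prev_head //.
case: p pth u Eb xp => [|z p] pth u Eb xp; first by rewrite Eb eqxx in ab.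
rewrite cycE cons_uniq xp u /=.
have [aV xa] := nbrsP _ _ _ ax; have [bV xb] := nbrsP _ _ _ bx.
rewrite {1}inducedE xV aV xa /=.
have /= : path (induced V) a (rcons (z :: p) x); last by [].
rewrite rcons_path -Eb [induced V b x]inducedE bV xV e_sym xb !andbT.
by apply: sub_path pth => s t; rewrite !inducedE !in_setD1 =>
  /and3P[/andP[_ ->] /andP[_ ->] ->].
Qed.

(** * Cyclomatic number and excess of a vertex *)

Definition edges V :=
  [set p : T * T | [&& enum_rank p.1 < enum_rank p.2, p.1 \in V, p.2 \in V & e p.1 p.2]].
Definition components V := [set component V x | x in V].
Definition touched V x := [set component (V :\ x) y | y in nbrs V x].
(** The subtraction is never truncated, by [cyclo_ge]; the one in [excess] is not either, by
    [touched_card]. *)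
Definition cyclo V := #|edges V| + #|components V| - #|V|.
Definition excess V x := #|nbrs V x| - #|touched V x|.

Lemma excessE V x : excess V x = #|nbrs V x| - #|touched V x|.
Proof. by []. Qed.

(** The edges at [x] correspond to its neighbours; [f] orders each pair as [edges] requires. *)
Lemma card_edges_del V x : x \in V -> #|edges V| = #|edges (V :\ x)| + #|nbrs V x|.
Proof.
move=> xV; pose f y := if enum_rank x < enum_rank y then (x, y) else (y, x).
have f_inj : {in nbrs V x &, injective f}.
  move=> y z; rewrite /f => _ _; case: ifP => _; case: ifP => _ [] //.
    by move=> -> ->.
  by move=> -> ->.
rewrite -(card_in_imset f_inj) -cardsUI.
suff -> : edges (V :\ x) :&: f @: nbrs V x = set0.
  rewrite cards0 addn0; congr #|pred_of_set _|; apply/setP => -[u v].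
  rewrite !inE /=; apply/and4P/orP.
    case=> uv uV vV euv; case: (eqVneq u x) => [ux|nux].
      right; apply/imsetP; exists v; first by rewrite inE vV -ux.
      by rewrite /f -ux uv.
    case: (eqVneq v x) => [vx|nvx]; last by left; rewrite uv uV vV.
    right; apply/imsetP; exists u; first by rewrite inE uV -vx e_sym.
    by rewrite /f -vx ltnNge (ltnW uv).
  case=> [/and4P[-> /andP[_ ->] /andP[_ ->] ->] // | /imsetP[y]].
  rewrite inE => /andP[yV xy]; rewrite /f; case: ltnP => lt [-> ->]; split=> //.
    rewrite ltn_neqAle lt andbT; apply/eqP => /val_inj /enum_rank_inj E.
    by rewrite E e_irr in xy.
  by rewrite e_sym.
apply/setP => p; rewrite !inE; apply/negP => /andP[/and4P[_ p1 p2 _] /imsetP[y _]].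
by rewrite /f; case: ifP => _ E; move: p1 p2; rewrite E /= eqxx.
Qed.

Lemma comp_id V x : x \in component V x. Proof. by rewrite inE. Qed.

Lemma comp_eq V x y : (component V x == component V y) = connect (induced V) x y.
Proof.
apply/eqP/idP => [E|xy]; first by have := comp_id V y; rewrite -E inE.
apply/setP => z; rewrite !inE.
exact: (same_connect (sym_connect_sym (@induced_sym V))).
Qed.

Lemma touched_sub V x : touched V x \subset components (V :\ x).
Proof.
apply/subsetP => K /imsetP[y ynb ->]; apply: imset_f.
by rewrite !inE (nbrs_neq ynb); case/nbrsP: ynb.
Qed.

Lemma touchedP V x v : x \in V -> v != x ->
  (component (V :\ x) v \in touched V x) = connect (induced V) x v.
Proof.
move=> xV vx; apply/imsetP/idP => [[y ynb] /eqP|xv].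
  rewrite comp_eq => vy; apply: (@connect_trans _ _ y).
    by apply: connect1; case/nbrsP: ynb => yV xy; rewrite inducedE xV yV.
  by rewrite conn_sym; apply: conn_mono vy; apply: subsetDl.
have [y ynb yv] := conn_first xv vx; exists y => //.
by apply/eqP; rewrite comp_eq conn_sym.
Qed.

(** Restoring [x] merges the touched components of [V :\ x] into the single component of [x] and
    leaves the others unchanged. *)
Lemma card_comps_del V x : x \in V ->
  #|components V| + #|touched V x| = #|components (V :\ x)| + 1.
Proof.
move=> xV.
have E : components V = component V x |: (components (V :\ x) :\: touched V x).
  have same v : v \in V -> v != x -> ~~ connect (induced V) x v ->
      component V v = component (V :\ x) v.
    move=> vV vx xv; apply/setP => z; rewrite !inE; apply/idP/idP; last first.
      by apply: conn_mono; apply: subsetDl.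
    case/connectP => p pth ->; apply/connectP; exists p => //.
    apply: path_avoid => //; apply: contra xv => /(path_connect pth).
    by rewrite conn_sym.
  apply/setP => K; rewrite !inE; apply/imsetP/orP => [[v vV ->]|].
    case: (boolP (connect (induced V) x v)) => xv.
      by left; rewrite eq_sym comp_eq.
    have vx : v != x by apply: contraNneq xv => ->.
    by right; rewrite same // touchedP // xv imset_f // !inE vx.
  case=> [/eqP ->|/andP[Kt /imsetP[v]]]; first by exists x.
  rewrite !inE => /andP[vx vV] EK; exists v => //; rewrite same //.
  by rewrite -touchedP // -EK.
have xn : component V x \notin components (V :\ x) :\: touched V x.
  rewrite inE negb_and negbK; apply/orP; right; apply/imsetP => -[v].
  rewrite !inE => /andP[vx vV] E'.
  have := comp_id V x; rewrite E' inE => /conn_in; rewrite !inE eqxx vx vV.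
  by move=> /(_ isT).
rewrite E cardsU1 xn cardsDS ?touched_sub //.
by have := subset_leq_card (touched_sub V x); lia.
Qed.

Lemma touched_card V x : #|touched V x| <= #|nbrs V x|.
Proof. exact: leq_imset_card. Qed.

Lemma set_ind_del (P : {set T} -> Prop) :
  P set0 -> (forall V x, x \in V -> P (V :\ x) -> P V) -> forall V, P V.
Proof.
move=> P0 PS V; elim: {V}#|V| {-2}V (erefl #|V|) => [|k IH] V.
  by move/eqP; rewrite cards_eq0 => /eqP ->.
move=> cV; have /card_gt0P[x xV] : 0 < #|V| by rewrite cV.
by apply: (PS V x xV); apply: IH; move: (cardsD1 x V); rewrite xV cV; case.
Qed.

(** Restoring a vertex [x] changes edges plus components minus vertices by
    [#|nbrs V x| - #|touched V x|], which is nonnegative. *)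
Lemma cyclo_ge V : #|V| <= #|edges V| + #|components V|.
Proof.
elim/set_ind_del: V => [|V x xV IH]; first by rewrite cards0.
have := card_edges_del xV; have := card_comps_del xV.
by have := touched_card V x; have := cardsD1 x V; rewrite xV; lia.
Qed.

Lemma cyclo_del V x : x \in V -> cyclo V = cyclo (V :\ x) + excess V x.
Proof.
move=> xV; rewrite /cyclo /excess.
have := card_edges_del xV; have := card_comps_del xV.
have := touched_card V x; have := cardsD1 x V; rewrite xV.
by have := cyclo_ge V; have := cyclo_ge (V :\ x); lia.
Qed.

Lemma cyclo0 : cyclo set0 = 0.
Proof.
rewrite /cyclo /components imset0 !cards0 addn0 subn0.
by apply/eqP; rewrite cards_eq0; apply/eqP/setP => p; rewrite !inE /= andbF.
Qed.

(** * Excess, cycles through a vertex, and disjointness of cycles *)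

Definition on_cyc V x := exists2 c, cyc V c & x \in c.

(** The excess vanishes exactly when distinct neighbours of [x] lie in distinct components of
    [V :\ x]. Two neighbours in one component close up to a cycle through [x]; conversely the two
    cycle neighbours of [x] share a component. *)
Lemma excess0P V x : x \in V -> (excess V x = 0) <-> ~ on_cyc V x.
Proof.
move=> xV; split.
  move=> E [c cy xc]; have ab := cyc_next_neq_prev cy xc.
  have an := cyc_next cy xc; have bn := cyc_prev cy xc.
  have /imset_injP inj : #|touched V x| == #|nbrs V x|.
    by rewrite eqn_leq touched_card; rewrite -subn_eq0 -/(excess V x) E.
  case/eqP: ab; apply: inj => //; apply/eqP; rewrite comp_eq.
  by apply: (cyc_conn cy); rewrite ?mem_next ?mem_prev ?(nbrs_neq an) ?(nbrs_neq bn).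
move=> H; apply/eqP; rewrite subn_eq0 leq_eqVlt eq_sym; apply/orP; left.
apply/imset_injP => a b an bn /eqP; rewrite comp_eq => ab; apply/eqP.
apply: contra_notT H => nab; have [c [cy xc _ _]] := conn_cyc an bn nab ab xV.
by exists c.
Qed.

Definition disjoint_cyc V := forall c1 c2 x, cyc V c1 -> cyc V c2 ->
  x \in c1 -> x \in c2 -> cyc_edge c1 =2 cyc_edge c2.

Lemma cyc_edgeE V c x y : cyc V c -> x \in c ->
  cyc_edge c x y = (y \in [:: next c x; prev c x]).
Proof.
move=> cy xc; have u := cyc_uniq cy; rewrite /cyc_edge xc !inE /=.
apply/andP/orP => [[yc /orP[/eqP <-|/eqP <-]]|[/eqP ->|/eqP ->]].
- by left.
- by right; rewrite prev_next.
- by rewrite mem_next eqxx.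
- by rewrite mem_prev next_prev // eqxx orbT.
Qed.

(** If neighbours [a] and [b] share a component, the only cycle through [x] passes through both. Any
    other such pair would give a cycle with different edges at [x], so sending a neighbour to its
    component is injective once [b] is dropped. *)
Lemma disjoint_excess V x : disjoint_cyc V -> x \in V -> excess V x <= 1.
Proof.
move=> D xV; have [/imset_injP H|] := boolP (#|touched V x| == #|nbrs V x|).
  by rewrite /excess /touched card_in_imset // subnn.
move/imset_injP => H.
have /existsP[a /existsP[b /and4P[an bn nab ab]]] : [exists a, exists b,
   [&& a \in nbrs V x, b \in nbrs V x, a != b & connect (induced (V :\ x)) a b]].
  apply: contraT => H'; case: H => a b an bn /eqP; rewrite comp_eq => ab.
  apply/eqP; apply: contraNT H' => nab; apply/existsP; exists a; apply/existsP; exists b.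
  by rewrite an bn nab.
have [c [cy xc nx px]] := conn_cyc an bn nab ab xV.
rewrite /excess leq_subLR addn1.
have inj : {in nbrs V x :\ b &, injective (component (V :\ x))}.
  move=> s t; rewrite !inE => /and3P[sb sV xs] /and3P[tb tV xt] /eqP.
  rewrite comp_eq => st; apply/eqP/negPn/negP => nst.
  have sn : s \in nbrs V x by rewrite inE sV.
  have tn : t \in nbrs V x by rewrite inE tV.
  have [c' [cy' xc' nx' px']] := conn_cyc sn tn nst st xV.
  have E y := D c c' x cy cy' xc xc' x y.
  have := E s; have := E t; rewrite !(cyc_edgeE _ cy) // !(cyc_edgeE _ cy') //.
  rewrite nx px nx' px' !inE !eqxx orbT /= (negPf sb) (negPf tb) !orbF.
  by move=> /eqP Et /eqP Es; rewrite Es Et eqxx in nst.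
have := cardsD1 b (nbrs V x); rewrite bn => ->; rewrite ltnS -(card_in_imset inj).
by apply/subset_leq_card/imsetS/subsetDl.
Qed.

(** If [a'] were a third neighbour sharing its component with another one, both [b] and [a'] could
    be dropped without losing a touched component, and the excess would be at least 2. *)
Lemma excess_uniq V x a b a' b' : excess V x <= 1 ->
  a \in nbrs V x -> b \in nbrs V x -> a != b -> connect (induced (V :\ x)) a b ->
  a' \in nbrs V x -> b' \in nbrs V x -> a' != b' -> connect (induced (V :\ x)) a' b' ->
  a' \in [:: a; b].
Proof.
move=> E an bn nab ab an' bn' nab' ab'; apply/negPn/negP.
rewrite !inE negb_or => /andP[a'a a'b].
have sub : touched V x \subset [set component (V :\ x) y | y in nbrs V x :\ b :\ a'].
  apply/subsetP => K /imsetP[y yn ->].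
  have Ha : component (V :\ x) a \in [set component (V :\ x) y | y in nbrs V x :\ b :\ a'].
    by apply: imset_f; rewrite !in_setD1 eq_sym a'a nab.
  have Hb : component (V :\ x) b \in [set component (V :\ x) y | y in nbrs V x :\ b :\ a'].
    by have /eqP <- : component (V :\ x) a == component (V :\ x) b by rewrite comp_eq.
  case: (eqVneq y b) => [->//|yb]; case: (eqVneq y a') => [->|ya].
    have /eqP -> : component (V :\ x) a' == component (V :\ x) b' by rewrite comp_eq.
    case: (eqVneq b' b) => [->//|bb]; apply: imset_f.
    by rewrite !in_setD1 eq_sym nab' bb.
  by apply: imset_f; rewrite !in_setD1 ya yb.
have := leq_trans (subset_leq_card sub) (leq_imset_card _ _).
have := cardsD1 b (nbrs V x); have := cardsD1 a' (nbrs V x :\ b).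
by rewrite in_setD1 a'b an' bn; move: E; rewrite /excess; lia.
Qed.

Lemma cyc_nbr_uniq V c x a b : excess V x <= 1 -> cyc V c -> x \in c ->
  a \in nbrs V x -> b \in nbrs V x -> a != b -> connect (induced (V :\ x)) a b ->
  a \in [:: next c x; prev c x].
Proof.
move=> E cy xc an bn nab ab.
have nn := cyc_next cy xc; have pn := cyc_prev cy xc.
apply: (excess_uniq E nn pn (cyc_next_neq_prev cy xc) _ an bn nab ab).
by apply: (cyc_conn cy); rewrite ?mem_next ?mem_prev ?(nbrs_neq nn) ?(nbrs_neq pn).
Qed.

Lemma cyc_closed c (P : T -> Prop) x : uniq c -> x \in c -> P x ->
  (forall y, y \in c -> P y -> P (next c y)) -> forall y, y \in c -> P y.
Proof.
move=> u xc Px H y yc; have fc := cycle_next u.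
have : fconnect (next c) x y by rewrite (fconnect_cycle fc xc).
case/connectP => p pth ->; elim: p x xc Px pth => [|z p IH] x xc Px //=.
by case/andP => /eqP <- pth; apply: IH => //; rewrite ?mem_next //; apply: H.
Qed.

(** At a common vertex [z] the two [c1]-neighbours are joined without [z], so by [cyc_nbr_uniq] they
    are also the [c2]-neighbours. Walking along [c1] from a common vertex carries this to all its
    vertices and edges. *)
Lemma excess_disjoint V : (forall x, x \in V -> excess V x <= 1) -> disjoint_cyc V.
Proof.
move=> E.
have key c1 c2 z : cyc V c1 -> cyc V c2 -> z \in c1 -> z \in c2 ->
    forall y, cyc_edge c1 z y -> cyc_edge c2 z y.
  move=> cy1 cy2 z1 z2 y; rewrite (cyc_edgeE _ cy1) // (cyc_edgeE _ cy2) //.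
  have nn := cyc_next cy1 z1; have pn := cyc_prev cy1 z1.
  have np := cyc_next_neq_prev cy1 z1.
  have Cn : connect (induced (V :\ z)) (next c1 z) (prev c1 z).
    by apply: (cyc_conn cy1); rewrite ?mem_next ?mem_prev ?(nbrs_neq nn) ?(nbrs_neq pn).
  have Ez := E _ (cyc_sub cy1 z1).
  rewrite in_cons mem_seq1 => /orP[] /eqP ->.
    exact: (cyc_nbr_uniq Ez cy2 z2 nn pn).
  by apply: (cyc_nbr_uniq Ez cy2 z2 pn nn); rewrite 1?eq_sym // conn_sym.
have sub c1 c2 x : cyc V c1 -> cyc V c2 -> x \in c1 -> x \in c2 ->
   forall y z, cyc_edge c1 y z -> cyc_edge c2 y z.
  move=> cy1 cy2 x1 x2 y z yz; have y1 : y \in c1 by case/andP: yz => /andP[].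
  apply: (key c1) => //.
  apply: (cyc_closed (P := fun y => y \in c2) (cyc_uniq cy1) x1) y1 => // t t1 t2.
  have : cyc_edge c1 t (next c1 t) by rewrite /cyc_edge t1 mem_next t1 eqxx.
  by move/(key c1 c2 t cy1 cy2 t1 t2) => /andP[/andP[]].
move=> c1 c2 x cy1 cy2 x1 x2 y z; apply/idP/idP; exact: sub x1 x2 _ _ || exact: sub x2 x1 _ _.
Qed.

Lemma disjoint_mem V c1 c2 x : disjoint_cyc V -> cyc V c1 -> cyc V c2 ->
  x \in c1 -> x \in c2 -> c1 =i c2.
Proof.
move=> D cy1 cy2 x1 x2 y; have E := D _ _ _ cy1 cy2 x1 x2 y.
have H c : y \in c -> cyc_edge c y (next c y).
  by move=> yc; rewrite /cyc_edge yc mem_next yc eqxx.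
by apply/idP/idP => [/H|/H]; [rewrite E|rewrite -E] => /andP[/andP[]].
Qed.

(** * Bridges and end blocks *)

Definition bridge V a b := [/\ a \in V, b \in nbrs V a &
  forall b', b' \in nbrs V a -> b' != b -> ~~ connect (induced (V :\ a)) b b'].

(** The condition says that no cycle uses the edge, seen from the endpoint [a]. A violation at [b]
    closes up to a cycle through the edge, whose other neighbour of [a] is a violation at [a]. *)
Lemma bridge_sym V a b : bridge V a b -> bridge V b a.
Proof.
case=> aV /nbrsP[bV ab] H; have bn : b \in nbrs V a by rewrite inE bV.
split=> //; first by rewrite inE aV e_sym.
move=> w wn wa; apply/negP => aw.
have an : a \in nbrs V b by rewrite inE aV e_sym.
have [|c [cy bc nx px]] := conn_cyc an wn _ aw bV; first by rewrite eq_sym.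
have ac : a \in c by rewrite -nx mem_next.
have pa : prev c a = b by rewrite -nx prev_next // (cyc_uniq cy).
have nn := cyc_next cy ac.
have nb : next c a != b by rewrite -pa (cyc_next_neq_prev cy).
have /negP := H _ nn nb; apply.
by apply: (cyc_conn cy); rewrite ?mem_next ?(nbrs_neq nn) ?(nbrs_neq bn).
Qed.

Lemma nonbridge V a b : a \in V -> b \in nbrs V a -> ~ bridge V a b ->
  exists2 b', b' \in nbrs V a & b' != b /\ connect (induced (V :\ a)) b b'.
Proof.
move=> aV bn nbr.
have [/existsP[b' /and3P[h1 h2 h3]]|H] := boolP [exists b',
  [&& b' \in nbrs V a, b' != b & connect (induced (V :\ a)) b b']]; first by exists b'.
case: nbr; split=> // b' bn' nb; apply: contraNN H => h; apply/existsP; exists b'.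
by rewrite bn' nb.
Qed.

Lemma nonbridge_cyc V c v w : excess V v <= 1 -> cyc V c -> v \in c ->
  w \in nbrs V v -> ~ bridge V v w -> w \in [:: next c v; prev c v].
Proof.
move=> E cy vc wn /(nonbridge (cyc_sub cy vc) wn)[w' wn' [ww' co]].
by apply: (cyc_nbr_uniq E cy vc wn wn') co; rewrite eq_sym.
Qed.

(** This covers chords too: without [v], the vertex [w] still reaches along the cycle a neighbour of
    [v] other than [w]. *)
Lemma cyc_nbr_nonbridge V c v w : cyc V c -> v \in c -> w \in c ->
  w \in nbrs V v -> ~ bridge V v w.
Proof.
move=> cy vc wc wn [_ _ H].
have nn := cyc_next cy vc; have pn := cyc_prev cy vc.
have [E|N] := eqVneq (next c v) w.
  have N : prev c v != w by rewrite -E eq_sym (cyc_next_neq_prev cy).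
  have /negP := H _ pn N; apply.
  by apply: (cyc_conn cy); rewrite ?mem_prev ?(nbrs_neq wn) ?(nbrs_neq pn).
have /negP := H _ nn N; apply.
by apply: (cyc_conn cy); rewrite ?mem_next ?(nbrs_neq wn) ?(nbrs_neq nn).
Qed.

(** The descent step for [ex_end_block]: the side of [w] beyond [v] is reached from [b] without
    passing [a], hence lies in the side of [b], and it misses [b] itself. *)
Lemma comp_lt V a b v w : a \in V -> w \in nbrs V v ->
  b != a -> b \in V -> connect (induced (V :\ a)) b v -> v != a -> v \in V ->
  ~~ connect (induced (V :\ v)) w a -> ~~ connect (induced (V :\ v)) w b ->
  #|component (V :\ v) w| < #|component (V :\ a) b|.
Proof.
move=> aV wn ba bV bv va vV wa wb; apply/proper_card/properP; split; last first.
  by exists b; rewrite ?comp_id // inE.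
have nwa : w != a by apply: contraNneq wa => ->.
apply/subsetP => z; rewrite !inE => wz; have := conn_avoid wz wa.
apply: connect_trans; apply: (connect_trans bv); apply: connect1.
by case/nbrsP: wn => wV vw; rewrite inducedE !inE va vV nwa wV.
Qed.

Definition cycle_nbrs V c v := nbrs V v = [set next c v; prev c v].

(** The extremal pieces of a graph with disjoint cycles: a vertex or cycle that is either a whole
    component or attached to the rest by a single edge. *)
Variant end_block V : Prop :=
| IsolatedVertex x of x \in V & nbrs V x = set0
| PendantVertex x y of x \in V & nbrs V x = [set y]
| IsolatedCycle c of cyc V c & forall v, v \in c -> cycle_nbrs V c v
| PendantCycle c b y of cyc V c & b \in c & y \notin c &
    nbrs V b = y |: [set next c b; prev c b] &
    forall v, v \in c -> v != b -> cycle_nbrs V c v.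

Lemma cycle_nbrsP V c v : excess V v <= 1 -> cyc V c -> v \in c ->
  (forall w, w \in nbrs V v -> ~ bridge V v w) -> cycle_nbrs V c v.
Proof.
move=> E cy vc H; apply/setP => w; rewrite in_set2; apply/idP/orP.
  move=> wn; have := nonbridge_cyc E cy vc wn (H _ wn).
  by rewrite !(inE, mem_seq1) => /orP.
by case=> /eqP ->; rewrite ?cyc_next ?cyc_prev.
Qed.

(** Without bridges, a vertex is isolated or lies on a cycle that is a whole component. Otherwise
    take a directed bridge from [a] to [b] with the fewest vertices on the side of [b]: no further
    bridge fits on that side, so it is a single vertex or a cycle through [b]. *)
Lemma ex_end_block V : (forall x, x \in V -> excess V x <= 1) -> V != set0 -> end_block V.
Proof.
move=> E /set0Pn[x0 x0V].
(* A boolean form of [bridge] on pairs, as minimisation over a finite type requires. *)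
pose br (p : T * T) := [&& p.1 \in V, p.2 \in nbrs V p.1 &
  [forall b', (b' \in nbrs V p.1) ==> (b' != p.2) ==> ~~ connect (induced (V :\ p.1)) p.2 b']].
have brP a b : reflect (bridge V a b) (br (a, b)).
  apply: (iffP and3P) => -[h1 h2 H]; split=> //=.
    by move=> b' bn nb; move/forallP/(_ b'): H; rewrite /= bn nb.
  by apply/forallP => b'; apply/implyP => bn; apply/implyP; apply: H.
have [/existsP[p0 p0br]|nobr] := boolP [exists p, br p]; last first.
  have nb a b : ~ bridge V a b.
    by move/brP => h; case/existsP: nobr; exists (a, b).
  have [E0|[w wn]] := set_0Vmem (nbrs V x0); last first.
    have [w' wn' [ww co]] := nonbridge x0V wn (@nb _ _).
    have [|c [cy xc _ _]] := conn_cyc wn wn' _ co x0V; first by rewrite eq_sym.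
    apply: (IsolatedCycle cy) => v vc; apply: cycle_nbrsP => //.
    exact: E (cyc_sub cy vc).
  exact: IsolatedVertex x0V E0.
case: (arg_minnP (fun p => #|component (V :\ p.1) p.2|) p0br) => -[a b] /brP ab /= min.
have minb v w : bridge V v w -> #|component (V :\ a) b| <= #|component (V :\ v) w|.
  by move/brP/min.
have [aV bn abH] := ab; have [bV eab] := nbrsP _ _ _ bn.
have ba : b != a := nbrs_neq bn.
have [_ an baH] := bridge_sym ab.
have [Eb|[w]] := set_0Vmem (nbrs V b :\ a).
  apply: (@PendantVertex _ b a) => //; apply/eqP; rewrite eqEsubset sub1set an andbT.
  by rewrite -setD_eq0 Eb.
rewrite in_setD1 => /andP[wa wn].
(* Another bridge at [b] would have a smaller far side than the minimal one. *)
have nbb w' : w' \in nbrs V b -> w' != a -> ~ bridge V b w'.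
  move=> wn' wa' br'; have := minb _ _ br'; rewrite leqNgt => /negP; apply.
  apply: comp_lt => //.
    by case: br' => _ _ H; apply: H => //; rewrite eq_sym.
  apply/negP => /conn_in; rewrite !inE eqxx /= (nbrs_neq wn').
  by case/nbrsP: wn' => -> _ /(_ isT).
have [w' wn' [ww co]] := nonbridge bV wn (nbb _ wn wa).
have [|c [cy bc _ _]] := conn_cyc wn wn' _ co bV; first by rewrite eq_sym.
have ac : a \notin c.
  apply/negP => ac; exact: (cyc_nbr_nonbridge cy ac bc bn ab).
apply: (PendantCycle cy bc ac).
  apply/setP => z; rewrite !inE; apply/idP/idP => [|/or3P[]/eqP ->].
  - move=> zV; have zn : z \in nbrs V b by rewrite inE.
    have [//|za] := eqVneq z a.
    have := nonbridge_cyc (E _ bV) cy bc zn (nbb _ zn za).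
    by rewrite !inE.
  - by have := an; rewrite inE.
  - by have := cyc_next cy bc; rewrite inE.
  - by have := cyc_prev cy bc; rewrite inE.
move=> v vc vb; have vV := cyc_sub cy vc.
apply: cycle_nbrsP => //; first exact: E.
move=> z zn brz; have := minb _ _ brz; rewrite leqNgt => /negP; apply.
have va : v != a by apply: contraNneq ac => <-.
(* If [z] reached [b] without [v], it would reach every other vertex of the cycle, in particular a
   neighbour of [v] different from [z], and the edge from [v] to [z] would not be a bridge. *)
have zb : ~~ connect (induced (V :\ v)) z b.
  apply/negP => zb; case: brz => _ _ H.
  have nn := cyc_next cy vc; have pn := cyc_prev cy vc.
  have bv : b != v by rewrite eq_sym.
  have conb t : t \in c -> t != v -> connect (induced (V :\ v)) z t.
    by move=> tc tv; apply: connect_trans zb _; apply: (cyc_conn cy).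
  have [En|N] := eqVneq (next c v) z.
    have N : prev c v != z by rewrite -En eq_sym (cyc_next_neq_prev cy).
    by have /negP := H _ pn N; apply; rewrite conb ?mem_prev ?(nbrs_neq pn).
  by have /negP := H _ nn N; apply; rewrite conb ?mem_next ?(nbrs_neq nn).
apply: comp_lt => //.
  exact: cyc_connect (cyc_del ac cy) bc vc.
apply: contra zb => za; apply: connect_trans za _; apply: connect1.
by rewrite inducedE !inE eq_sym va aV eq_sym vb bV.
Qed.
End Graph.

(** * Independence number and cycle structure *)

Lemma card_setU_disjoint (T : finType) (A B : {set T}) :
  [disjoint A & B] -> #|A :|: B| = #|A| + #|B|.
Proof. by rewrite -leq_card_setU => /eqP. Qed.

Section Indep.
Variables (T : finType) (e : rel T).
Implicit Types (V A B S : {set T}).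

Lemma independentP S :
  reflect {in S &, forall x y, ~~ e x y} (independent e S).
Proof.
apply: (iffP forall_inP) => H x; first by move=> y xS; apply: (forall_inP (H x xS)).
by move=> xS; apply/forall_inP => y; apply: H.
Qed.

Lemma independentS A B : A \subset B -> independent e B -> independent e A.
Proof.
move=> sAB /independentP H; apply/independentP => x y xA yA.
by apply: H; apply: (subsetP sAB).
Qed.

Lemma independent0 : independent e set0.
Proof. by apply/independentP => x y; rewrite inE. Qed.

Lemma indep_num_ge V S : S \subset V -> independent e S -> #|S| <= indep_num V e.
Proof.
move=> sSV iS; pose P (R : {set T}) := (R \subset V) && independent e R.
by apply: (leq_bigmax_cond (P := P) (F := fun R : {set T} => #|R|)); rewrite /P sSV.
Qed.

Lemma indep_num_ex V :
  exists S, [/\ S \subset V, independent e S & #|S| = indep_num V e].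
Proof.
have P0 : (set0 \subset V) && independent e set0 by rewrite sub0set independent0.
pose S := [arg max_(S > set0 | (S \subset V) && independent e S) #|S|].
have [/andP[sV iS] max] : ((S \subset V) && independent e S) /\
    (forall S', (S' \subset V) && independent e S' -> #|S'| <= #|S|).
  by rewrite /S; case: arg_maxnP.
exists S; split=> //; apply/eqP; rewrite eqn_leq indep_num_ge //=.
by apply/bigmax_leqP.
Qed.

Lemma indep_num_mono A B : A \subset B -> indep_num A e <= indep_num B e.
Proof.
move=> sAB; have [S [sS iS <-]] := indep_num_ex A.
by apply: indep_num_ge iS; apply: subset_trans sAB.
Qed.

Lemma indep_num_cover V A B : V \subset A :|: B ->
  indep_num V e <= indep_num A e + indep_num B e.
Proof.
move=> sV; have [S [sS iS <-]] := indep_num_ex V.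
rewrite -(cardsID A S); apply: leq_add; apply: indep_num_ge.
- exact: subsetIr.
- by apply: independentS iS; apply: subsetIl.
- apply/subsetP => x; rewrite inE => /andP[xA xS].
  by move/subsetP/(_ _ xS): sS => /(subsetP sV); rewrite inE (negPf xA).
- by apply: independentS iS; apply: subsetDl.
Qed.

Lemma indep_num_card A : indep_num A e <= #|A|.
Proof. by have [S [sS _ <-]] := indep_num_ex A; apply: subset_leq_card. Qed.

Lemma indep_num_edge x y : e x y -> indep_num [set x; y] e <= 1.
Proof.
move=> xy; have [S [sS /independentP iS <-]] := indep_num_ex [set x; y].
rewrite leqNgt; apply/negP => /card_gt1P[u [v [uS vS uv]]].
have := subsetP sS _ uS; have := subsetP sS _ vS; rewrite !inE.
move=> /orP[]/eqP Ev /orP[]/eqP Eu; rewrite Eu Ev ?eqxx // in uv uS vS.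
  by have := iS _ _ vS uS; rewrite xy.
by have := iS _ _ uS vS; rewrite xy.
Qed.

Lemma indep_num_del V x : indep_num V e <= (indep_num (V :\ x) e).+1.
Proof.
rewrite -add1n -(cards1 x); apply: leq_trans (leq_add (indep_num_card _) (leqnn _)).
by apply: indep_num_cover; apply/subsetP => z zV; rewrite !inE zV andbT orbN.
Qed.

Lemma indep_num_del_edge V x y : e x y ->
  indep_num V e <= (indep_num (V :\ x :\ y) e).+1.
Proof.
move=> xy; rewrite -add1n; apply: leq_trans (leq_add (indep_num_edge xy) (leqnn _)).
apply: indep_num_cover; apply/subsetP => z zV; rewrite !inE zV andbT.
by case: eqP => //=; case: eqP.
Qed.

Hypothesis e_sym : symmetric e.

Lemma independentU A B : independent e A -> independent e B ->
  (forall x y, x \in A -> y \in B -> ~~ e x y) -> independent e (A :|: B).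
Proof.
move=> /independentP iA /independentP iB AB; apply/independentP => x y.
rewrite !inE => /orP[xA|xB] /orP[yA|yB]; try by [apply: iA|apply: iB|apply: AB].
by rewrite e_sym AB.
Qed.

Lemma indep_num_join V A B : A :|: B \subset V -> [disjoint A & B] ->
  (forall x y, x \in A -> y \in B -> ~~ e x y) ->
  indep_num A e + indep_num B e <= indep_num V e.
Proof.
move=> sV dAB AB; have [S [sS iS <-]] := indep_num_ex A.
have [R [sR iR <-]] := indep_num_ex B.
have dSR : [disjoint S & R] by apply: disjointWl sS _; apply: disjointWr sR _.
rewrite -card_setU_disjoint //.
apply: indep_num_ge; first by apply: subset_trans sV; apply: setUSS.
by apply: independentU => // x y xS yR; apply: AB; rewrite ?(subsetP sS) ?(subsetP sR).
Qed.

End Indep.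

Lemma on_common_cycleP (T : finType) (r : rel T) x y :
  reflect (exists c, [/\ is_cycle r c, x \in c & y \in c]) (on_common_cycle r x y).
Proof.
apply: (iffP existsP) => [[k /existsP[t /and3P[h1 h2 h3]]]|[c [cy xc yc]]].
  by exists t.
have sz : size c < #|T|.+1.
  by rewrite ltnS -(card_uniqP _) ?max_card //; case/and3P: cy.
by exists (Ordinal sz); apply/existsP; exists (in_tuple c); rewrite cy xc yc.
Qed.

(** * Deleting and restoring vertices under conditions (i)-(iii) *)

Section Structure.
Variables (T : finType) (e : rel T).
Hypotheses (e_sym : symmetric e) (e_irr : irreflexive e).
Implicit Types (V A B : {set T}) (x y : T) (c : seq T).

Local Notation alpha V := (indep_num V e).
Local Notation cyc := (cyc e).
Local Notation nbrs := (nbrs e).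
Local Notation induced := (induced e).

Definition cyc_verts V := [set x | on_common_cycle (induced V) x x].
Definition tree_verts V := V :\: cyc_verts V.
Local Notation C := cyc_verts.
Local Notation Gam := tree_verts.

Lemma cyc_vertsP V x : reflect (on_cyc e V x) (x \in C V).
Proof.
rewrite inE; apply: (iffP (on_common_cycleP _ _ _)) => [[c [cy xc _]]|[c cy xc]].
  by exists c.
by exists c.
Qed.

Lemma mem_cyc_verts V c x : cyc V c -> x \in c -> x \in C V.
Proof. by move=> cy xc; apply/cyc_vertsP; exists c. Qed.

Lemma cyc_verts_sub V : C V \subset V.
Proof. by apply/subsetP => x /cyc_vertsP[c cy xc]; apply: (cyc_sub cy xc). Qed.

Lemma tree_verts_sub V : Gam V \subset V. Proof. exact: subsetDl. Qed.

Lemma excess_eq V x : disjoint_cyc e V -> x \in V -> excess e V x = (x \in C V).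
Proof.
move=> D xV; case: cyc_vertsP => on.
  have := disjoint_excess e_sym e_irr D xV.
  case: (posnP (excess e V x)) => [/(excess0P e_sym e_irr xV)//|]; lia.
by apply/(excess0P e_sym e_irr xV).
Qed.

Lemma disjoint_del V x : disjoint_cyc e V -> disjoint_cyc e (V :\ x).
Proof.
move=> D c1 c2 z; rewrite !cyc_delE => /andP[_ cy1] /andP[_ cy2].
exact: D.
Qed.

Lemma cyc_del_tree V x c : x \notin C V -> cyc (V :\ x) c = cyc V c.
Proof.
move=> xC; rewrite cyc_delE; case: (boolP (cyc V c)) => [cy|]; rewrite ?andbF //.
by rewrite andbT; apply: contraNN xC => /(mem_cyc_verts cy).
Qed.

Lemma cyc_verts_del_tree V x : x \notin C V -> C (V :\ x) = C V.
Proof.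
by move=> xC; apply/setP => z; apply/cyc_vertsP/cyc_vertsP => -[c cy zc];
  exists c => //; rewrite ?cyc_del_tree // in cy *.
Qed.

Lemma tree_verts_del_tree V x : x \notin C V -> Gam (V :\ x) = Gam V :\ x.
Proof.
by move=> xC; apply/setP => z; rewrite /Gam cyc_verts_del_tree // !in_set andbCA.
Qed.

(** A cycle of [V] survives the deletion of [x] exactly when it is disjoint from [c], so precisely
    the vertices of [c] leave the cycles. *)
Lemma cyc_verts_del_cyc V c x : disjoint_cyc e V -> cyc V c -> x \in c ->
  C (V :\ x) = C V :\: [set z in c].
Proof.
move=> D cy xc; apply/setP => z; rewrite in_setD in_set.
apply/cyc_vertsP/andP => [[c']|[zc /cyc_vertsP[c' cy' zc']]].
  rewrite cyc_delE => /andP[xc' cy'] zc'; split; last exact: mem_cyc_verts zc'.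
  by apply: contra xc' => zc; rewrite (disjoint_mem D cy' cy zc' zc).
exists c' => //; rewrite cyc_delE cy' andbT.
by apply: contra zc => xc'; rewrite -(disjoint_mem D cy' cy xc' xc).
Qed.

Lemma tree_verts_del_cyc V c x : disjoint_cyc e V -> cyc V c -> x \in c ->
  Gam (V :\ x) = Gam V :|: [set z in c] :\ x.
Proof.
move=> D cy xc; apply/setP => z; rewrite /Gam (cyc_verts_del_cyc D cy xc) !in_set.
have xC := mem_cyc_verts cy xc; rewrite inE in xC.
have [->|zx] := eqVneq z x; first by rewrite xC xc inE eqxx.
case: (boolP (z \in c)) => zc /=; last by rewrite andbF orbF inE zx.
by rewrite (cyc_sub cy zc) inE zx orbT.
Qed.

Lemma tree_cycD V : [disjoint Gam V & C V].
Proof. by rewrite disjoints_subset /Gam; apply/subsetP => z; rewrite !inE => /andP[]. Qed.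

Lemma verts_cover V : V \subset Gam V :|: C V.
Proof. by apply/subsetP => z zV; rewrite in_setU in_setD zV andbT orNb. Qed.

Lemma alpha_cover V : alpha V <= alpha (Gam V) + alpha (C V).
Proof. exact/indep_num_cover/verts_cover. Qed.

Variable good : seq T -> Prop.

(* Given [st_disjoint], the last two fields are equivalent to condition (iii). *)
Record structured V : Prop := Structured {
  st_disjoint : disjoint_cyc e V;
  st_good : forall c, cyc V c -> good c;
  st_apart : forall x y, x \in C V -> y \in C V -> e x y ->
    exists c, [/\ cyc V c, x \in c & y \in c];
  st_indep : exists I : {set T}, [/\ I \subset Gam V, independent e I,
    alpha (Gam V) <= #|I| & forall x y, x \in I -> y \in C V -> ~~ e x y] }.

(** The set [I] has no neighbour on a cycle, so it can be joined to any maximum independent set of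
    the cycle vertices. With [alpha_cover] this gives equality. *)
Lemma structured_alpha V : structured V -> alpha (Gam V) + alpha (C V) <= alpha V.
Proof.
case=> _ _ _ [I [sI iI cI nI]]; have [S [sS iS ES]] := indep_num_ex e (C V).
have cov := subset_trans sI (tree_verts_sub V).
have dIS : [disjoint I & S].
  by apply: disjointWl sI _; apply: disjointWr sS _; apply: tree_cycD.
have cIS := card_setU_disjoint dIS.
apply: leq_trans (leq_add cI (leqnn _)) _; rewrite -ES -cIS; apply: indep_num_ge.
  by rewrite subUset cov (subset_trans sS) // cyc_verts_sub.
by apply: independentU => // x y xI yS; apply: nI => //; apply: (subsetP sS).
Qed.

Lemma structured_acyclic V : C V = set0 -> structured V.
Proof.
move=> C0; have nc c : ~ cyc V c.
  case: c => [|z c] cy //; have := mem_cyc_verts cy (mem_head _ _).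
  by rewrite C0 inE.
split.
- by move=> c1 c2 x /nc.
- by move=> c /nc.
- by move=> x y; rewrite C0 inE.
have [I [sI iI EI]] := indep_num_ex e (Gam V); exists I; split=> //; first by rewrite EI.
by move=> x y _; rewrite C0 inE.
Qed.

(** Being adjacent to a cycle, [y] is outside [I], so [I] still serves after the deletion and the
    independence number of the tree part does not drop. *)
Lemma structured_del_nbr V y z : structured V -> y \in Gam V -> z \in C V -> e y z ->
  structured (V :\ y) /\ alpha V <= alpha (V :\ y).
Proof.
move=> sV; have := sV; case=> D G A [I [sI iI cI nI]] yG zC yz.
have yC : y \notin C V by case/setDP: yG.
have yI : y \notin I by apply/negP => /nI/(_ zC); rewrite yz.
have sIy : I \subset Gam V :\ y by rewrite subsetD1 sI.
have le : alpha (Gam V) <= alpha (Gam V :\ y).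
  by apply: leq_trans cI _; apply: indep_num_ge.
have sVy : structured (V :\ y).
  split; first exact: disjoint_del.
  - by move=> c; rewrite cyc_del_tree // => /G.
  - move=> u v; rewrite cyc_verts_del_tree // => uC vC /(A _ _ uC vC)[c [cy uc vc]].
    by exists c; rewrite cyc_del_tree.
  exists I; rewrite cyc_verts_del_tree // tree_verts_del_tree //; split=> //.
  by apply: leq_trans cI; apply/indep_num_mono/subsetDl.
split=> //; have := structured_alpha sVy; have := alpha_cover V.
by rewrite cyc_verts_del_tree // tree_verts_del_tree //; lia.
Qed.

Lemma structured_add_isolated V x : x \in V -> nbrs V x = set0 ->
  structured (V :\ x) -> structured V.
Proof.
move=> xV nx [D G A [I [sI iI cI nI]]].
have nxe y : y \in V -> ~~ e x y.
  by move=> yV; apply/negP => xy; have := in_set0 y; rewrite -nx inE yV xy.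
have xC : x \notin C V.
  apply/negP => /cyc_vertsP[c cy xc]; have := cyc_next cy xc.
  by rewrite nx inE.
rewrite cyc_verts_del_tree // tree_verts_del_tree // in A sI cI nI.
have xG : x \in Gam V by rewrite in_setD xC.
split.
- move=> c1 c2 z cy1 cy2; apply: D; by rewrite cyc_del_tree.
- by move=> c cy; apply: G; rewrite cyc_del_tree.
- move=> u v uC vC /(A _ _ uC vC)[c [cy uc vc]]; exists c.
  by rewrite cyc_del_tree in cy.
have xI : x \notin I by move: sI; rewrite subsetD1 => /andP[].
have sIV : I \subset Gam V by apply: subset_trans sI _; apply: subsetDl.
exists (x |: I); split.
- by rewrite subUset sub1set xG.
- apply: independentU => //.
    by apply/independentP => u v /set1P-> /set1P->; rewrite e_irr.
  move=> u v /set1P-> vI; apply: nxe; exact: (subsetP (tree_verts_sub V)) (subsetP sIV _ vI).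
- by rewrite cardsU1 xI; have := indep_num_del e (Gam V) x; lia.
- move=> u v /setU1P[->|uI] vC; last exact: nI.
  by apply: nxe; apply: (subsetP (cyc_verts_sub V)).
Qed.


(** The set [I] for the smaller graph is extended by [x], whose only neighbour [y] is neither in [I]
    nor on a cycle. *)
Lemma structured_add_pendant V x y : x \in V -> nbrs V x = [set y] -> y \notin C V ->
  structured (V :\ x :\ y) -> structured V.
Proof.
move=> xV nx yC [D G A [I [sI iI cI nI]]].
have [yV xy] : y \in V /\ e x y by apply/nbrsP; rewrite nx set11.
have nxe z : z \in V -> z != y -> ~~ e x z.
  by move=> zV; apply: contraNN => xz; rewrite -in_set1 -nx inE zV.
have xC : x \notin C V.
  apply/negP => /cyc_vertsP[c cy xc]; have := cyc_next_neq_prev cy xc.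
  have := cyc_next cy xc; have := cyc_prev e_sym cy xc.
  by rewrite nx !inE => /eqP-> /eqP->; rewrite eqxx.
have yC' : y \notin C (V :\ x) by rewrite cyc_verts_del_tree.
rewrite cyc_verts_del_tree // tree_verts_del_tree // in A sI cI nI.
rewrite cyc_verts_del_tree // tree_verts_del_tree // in A sI cI nI.
have E c : cyc (V :\ x :\ y) c = cyc V c by rewrite !cyc_del_tree.
have xG : x \in Gam V by rewrite in_setD xC.
split.
- by move=> c1 c2 z cy1 cy2; apply: D; rewrite E.
- by move=> c cy; apply: G; rewrite E.
- by move=> u v uC vC /(A _ _ uC vC)[c [cy uc vc]]; exists c; rewrite E in cy.
have /andP[sI' yI] : (I \subset Gam V :\ x) && (y \notin I) by rewrite -subsetD1.
have /andP[sIV xI] : (I \subset Gam V) && (x \notin I) by rewrite -subsetD1.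
exists (x |: I); split.
- by rewrite subUset sub1set xG.
- apply: independentU => //.
    by apply/independentP => u v /set1P-> /set1P->; rewrite e_irr.
  move=> u v /set1P-> vI; apply: nxe; last by apply: contraNneq yI => <-.
  exact: (subsetP (tree_verts_sub V)) (subsetP sIV _ vI).
- by rewrite cardsU1 xI; have := indep_num_del_edge (Gam V) xy; lia.
- move=> u v /setU1P[->|uI] vC; last exact: nI.
  by apply: nxe; [apply: (subsetP (cyc_verts_sub V))|apply: contraNneq yC => <-].
Qed.

(** If a maximum independent set contains [x], shift its part on the cycle one step along [next].
    The cycle is a component, so the result is independent of the same size; it avoids [x] because
    [prev c x], adjacent to [x], was not in the set. *)
Lemma alpha_rot V c x : cyc V c -> (forall v, v \in c -> cycle_nbrs e V c v) ->
  x \in c -> alpha V <= alpha (V :\ x).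
Proof.
move=> cy nb xc; have u := cyc_uniq cy.
have [S [sS /independentP iS <-]] := indep_num_ex e V.
have [xS|xS] := boolP (x \in S); last first.
  apply: indep_num_ge; last exact/independentP.
  by rewrite subsetD1 sS.
have adj v w : v \in c -> w \in V -> e v w -> w \in [:: next c v; prev c v].
  move=> vc wV vw; have : w \in nbrs V v by rewrite inE wV.
  by rewrite nb // !inE.
pose f := next c; pose N := [set f z | z in S :&: [set z in c]].
have f_inj : injective f by apply: can_inj (prev_next u).
have NP z : z \in N -> [/\ z \in c & prev c z \in S].
  case/imsetP => t; rewrite !inE => /andP[tS tc] ->.
  by rewrite mem_next tc prev_next.
have dN : [disjoint S :\: [set z in c] & N].
  rewrite disjoint_subset; apply/subsetP => z; rewrite !inE => /andP[zc _].
  by apply: contra zc => /NP[].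
have <- : #|(S :\: [set z in c]) :|: N| = #|S|.
  by rewrite card_setU_disjoint // card_imset // -(cardsID [set z in c] S) addnC.
have cV z : z \in c -> z \in V by apply: cyc_sub cy.
apply: indep_num_ge.
  rewrite subUset; apply/andP; split; apply/subsetP => z.
    rewrite !inE => /andP[zc zS]; rewrite (subsetP sS) // andbT.
    by apply: contraNneq zc => ->.
  case/NP => zc pS; rewrite !inE cV // andbT; apply: contraTneq isT => zx.
  have := iS _ _ pS xS; rewrite -zx e_sym; have := cyc_prev e_sym cy zc.
  by rewrite inE => /andP[_ ->].
apply: independentU => //.
- by apply/independentP => z t; rewrite !inE => /andP[_ zS] /andP[_ tS]; apply: iS.
- apply/independentP => z t /NP[zc pz] /NP[tc pt]; apply/negP => zt.
  have : t \in [:: next c z; prev c z] by apply: adj => //; apply: cV.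
  rewrite !inE => /orP[] /eqP Et.
    have := iS _ _ pz pt; rewrite Et prev_next // e_sym.
    by have := cyc_prev e_sym cy zc; rewrite inE => /andP[_ ->].
  have := iS _ _ pz pt; rewrite -Et.
  by have := cyc_prev e_sym cy tc; rewrite inE => /andP[_ ->].
- move=> z t; rewrite !inE => /andP[zc zS] /NP[tc pt]; apply/negP => zt.
  have : z \in [:: next c t; prev c t] by apply: adj; rewrite ?(subsetP sS) // e_sym.
  rewrite !inE => /orP[] /eqP Ez; move: zc; rewrite Ez ?mem_next ?mem_prev tc //.
Qed.

(** Inside the subgraph induced by its own vertices the cycle is a component, whatever is attached
    at [b], so [alpha_rot] applies there. *)
Lemma alpha_cycle V c b : cyc V c -> b \in c ->
  (forall v, v \in c -> v != b -> cycle_nbrs e V c v) ->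
  (forall z, z \in nbrs V b -> z \in c -> z \in [:: next c b; prev c b]) ->
  alpha [set z in c] <= alpha ([set z in c] :\ b).
Proof.
move=> cy bc nb nbb; set K := [set z in c].
have cyK : cyc K c.
  case/and3P: cy => s u cyc; rewrite cycE s u /=.
  apply: (sub_in_cycle (P := mem c)) cyc; last by apply/allP.
  by move=> z t zc tc /and3P[_ _ zt]; rewrite inducedE !inE zc tc.
apply: (alpha_rot cyK) => // v vc; apply/setP => z; rewrite in_set2.
apply/idP/orP => [|[]/eqP->]; last first.
- exact: (cyc_prev e_sym cyK).
- exact: (cyc_next cyK).
rewrite !inE => /andP[zc vz]; have zn : z \in nbrs V v by rewrite inE (cyc_sub cy zc).
have [vb|vb] := eqVneq v b; last by move: zn; rewrite nb // in_set2 => /orP.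
by rewrite vb in zn *; have := nbb _ zn zc; rewrite !inE => /orP.
Qed.

(** The set [I] for [V :\ x] may use vertices of the path left from [c]; these are discarded. At
    most [alpha (K :\ x)] vertices are lost, which is what that path contributes to the tree part of
    [V :\ x]. *)
Lemma structured_add_cycle V c x : disjoint_cyc e V -> cyc V c -> x \in c ->
  (forall v, v \in c -> cycle_nbrs e V c v) ->
  (forall c', cyc V c' -> x \in c' -> good c') ->
  structured (V :\ x) -> structured V.
Proof.
move=> D cy xc nb gd [_ G A [I [sI iI cI nI]]].
rewrite (cyc_verts_del_cyc D cy xc) (tree_verts_del_cyc D cy xc) in A sI cI nI.
have nbc u v : u \in c -> v \in V -> e u v -> v \in c.
  move=> uc vV uv; have : v \in nbrs V u by rewrite inE vV.
  by rewrite nb // !inE => /orP[]/eqP->; rewrite ?mem_next ?mem_prev.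
split=> //.
- move=> c' cy'; have [xc'|xc'] := boolP (x \in c'); first exact: gd.
  by apply: G; rewrite cyc_delE xc'.
- move=> u v uC vC uv; have vV := subsetP (cyc_verts_sub V) _ vC.
  have [uc|uc] := boolP (u \in c); first by exists c; split=> //; apply: nbc uv.
  have vc : v \notin c.
    apply: contra uc => vc; apply: (nbc v) => //; last by rewrite e_sym.
    exact: (subsetP (cyc_verts_sub V)).
  have uK : u \in C V :\: [set z in c] by rewrite in_setD uC andbT inE.
  have vK : v \in C V :\: [set z in c] by rewrite in_setD vC andbT inE.
  have [c' [cy' uc' vc']] := A u v uK vK uv.
  by exists c'; move: cy'; rewrite cyc_delE => /andP[_ ->].
set K := [set z in c] in sI cI nI.
have dG z : z \in c -> z \notin Gam V.
  by move=> zc; rewrite in_setD (mem_cyc_verts cy zc).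
exists (I :\: K); split.
- apply/subsetP => z; rewrite in_setD inE => /andP[zc /(subsetP sI)].
  by rewrite !inE (negPf zc) andbF orbF.
- by apply: independentS iI; apply: subsetDl.
- have : alpha (Gam V) + alpha (K :\ x) <= alpha (Gam V :|: K :\ x).
    apply: indep_num_join => //.
      rewrite disjoint_subset; apply/subsetP => z zG; rewrite !inE negb_and.
      by rewrite orbC (contraTN (@dG z)).
    move=> u v uG; rewrite !inE => /andP[_ vc]; apply/negP => uv.
    have uc : u \in c.
      apply: nbc vc _ _; last by rewrite e_sym.
      exact: subsetP (tree_verts_sub V) _ uG.
    by move/dG: uc; rewrite uG.
  have : #|I :&: K| <= alpha (K :\ x).
    apply: indep_num_ge; last by apply: independentS iI; apply: subsetIl.
    apply/subsetP => z; rewrite in_setI => /andP[/(subsetP sI)].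
    rewrite in_setU => /orP[zG|//]; first by rewrite inE => /dG; rewrite zG.
  by have := cardsID K I; lia.
move=> u v; rewrite in_setD inE => /andP[uc uI] vC.
have [vc|vc] := boolP (v \in c); last by apply: nI => //; rewrite in_setD inE vc vC.
apply: contra uc => uv; apply: nbc vc _ _; last by rewrite e_sym.
move/(subsetP sI): uI; rewrite in_setU => /orP[|]; last first.
  by rewrite !inE => /andP[_ /(cyc_sub cy)].
exact: (subsetP (tree_verts_sub V)).
Qed.

Lemma structured_add_pendant_cycle V c b y : disjoint_cyc e V -> cyc V c -> b \in c ->
  y \notin c -> nbrs V b = y |: [set next c b; prev c b] ->
  (forall v, v \in c -> v != b -> cycle_nbrs e V c v) ->
  y \notin C V -> structured (V :\ y) -> structured (V :\ b) ->
  alpha V <= alpha (V :\ y) -> structured V.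
Proof.
move=> D cy bc yc nb nbv yC sy sb le.
have [yV eby] : y \in V /\ e b y by apply/nbrsP; rewrite nb setU11.
have nbc u v : u \in c -> u != b -> v \in V -> e u v -> v \in c.
  move=> uc ub vV uv; have : v \in nbrs V u by rewrite inE vV.
  by rewrite nbv // !inE => /orP[]/eqP->; rewrite ?mem_next ?mem_prev.
case: (sy) => _ G A [I [sI iI cI nI]].
rewrite cyc_verts_del_tree // tree_verts_del_tree // in A sI cI nI.
split=> //.
- by move=> c' cy'; apply: G; rewrite cyc_del_tree.
- by move=> u v uC vC /(A _ _ uC vC)[c' [cy' uc vc]]; exists c'; rewrite cyc_del_tree // in cy'.
(* The set of [V :\ y] is kept, so it remains to see that restoring [y] does not raise the
   independence number of the tree part. *)
exists I; split=> //; first by apply: subset_trans sI _; apply: subsetDl.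
apply: leq_trans cI.
have dG z : z \in c -> z \notin Gam V.
  by move=> zc; rewrite in_setD (mem_cyc_verts cy zc).
set K := [set z in c].
(* With [h1] to [h4], alpha of the tree part plus alpha of the cycle vertices is at most
   [alpha (V :\ b)]. By [h5] and the hypothesis this is at most [alpha (V :\ y)], and [h6] bounds
   that by the same sum without [y]. *)
have h1 : alpha (Gam V) + alpha (K :\ b) <= alpha (Gam V :|: K :\ b).
  apply: indep_num_join => //.
    rewrite disjoint_subset; apply/subsetP => z zG; rewrite !inE negb_and.
    by rewrite orbC (contraTN (@dG z)).
  move=> u v uG; rewrite !inE => /andP[vb vc]; apply/negP => uv.
  have uc : u \in c.
    apply: nbc vc vb _ _; last by rewrite e_sym.
    exact: subsetP (tree_verts_sub V) _ uG.
  by move/dG: uc; rewrite uG.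
have h2 : alpha K <= alpha (K :\ b).
  apply: (alpha_cycle cy bc nbv) => z; rewrite nb !inE => /orP[/eqP->|//].
  by rewrite (negPf yc).
have h3 : alpha (C V) <= alpha K + alpha (C V :\: K).
  by apply: indep_num_cover; apply/subsetP => z zC; rewrite in_setU in_setD zC andbT orbN.
have h4 := structured_alpha sb.
rewrite (cyc_verts_del_cyc D cy bc) (tree_verts_del_cyc D cy bc) in h4.
have h5 : alpha (V :\ b) <= alpha V by apply/indep_num_mono/subsetDl.
have h6 := alpha_cover (V :\ y).
rewrite cyc_verts_del_tree // tree_verts_del_tree // in h6.
by move: h4; rewrite -/K; lia.
Qed.

(** With no edge between tree and cycle vertices, a neighbour of a cycle vertex lies on a cycle,
    hence on the same one; such an edge is not a bridge. *)
Lemma structured_cycle_nbrs V c : structured V ->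
  (forall y z, y \in Gam V -> z \in C V -> ~~ e y z) -> cyc V c ->
  forall v, v \in c -> cycle_nbrs e V c v.
Proof.
move=> [D G A _] nGC cy v vc; have vV := cyc_sub cy vc.
apply: cycle_nbrsP => //; first exact: disjoint_excess.
move=> w wn; apply: (cyc_nbr_nonbridge e_sym e_irr cy vc _ wn) => //.
have vC := mem_cyc_verts cy vc; have [wV vw] := nbrsP _ _ _ _ wn.
have wC : w \in C V.
  apply: contraT => wC; have := nGC w v; rewrite in_setD wC wV vC e_sym vw.
  by move/(_ isT isT).
have [c' [cy' vc' wc']] := A _ _ vC wC vw.
by rewrite (disjoint_mem D cy cy' vc vc').
Qed.

(** The rest of [c] joins the tree part as a separate path, so [I] is enlarged by a maximum
    independent set of that path. *)
Lemma structured_del_cycle V c x : structured V ->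
  (forall v, v \in c -> cycle_nbrs e V c v) -> cyc V c -> x \in c ->
  structured (V :\ x).
Proof.
move=> [D G A [I [sI iI cI nI]]] nb cy xc.
have nbc u v : u \in c -> v \in V -> e u v -> v \in c.
  move=> uc vV uv; have : v \in nbrs V u by rewrite inE vV.
  by rewrite nb // !inE => /orP[]/eqP->; rewrite ?mem_next ?mem_prev.
split; first exact: disjoint_del.
- by move=> c'; rewrite cyc_delE => /andP[_ /G].
- move=> u v; rewrite (cyc_verts_del_cyc D cy xc) !in_setD !in_set.
  case/andP=> uc uC /andP[vc vC] uv.
  have uK : u \in C V by rewrite inE.
  have vK : v \in C V by rewrite inE.
  have [c' [cy' uc' vc']] := A u v uK vK uv.
  exists c'; rewrite cyc_delE cy' uc' vc'; split=> //.
  by rewrite andbT; apply: contra uc => xc'; rewrite -(disjoint_mem D cy' cy xc' xc).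
rewrite (cyc_verts_del_cyc D cy xc) (tree_verts_del_cyc D cy xc).
set K := [set z in c].
have [S [sS iS ES]] := indep_num_ex e (K :\ x).
have Sc z : z \in S -> z \in c by move/(subsetP sS); rewrite !inE => /andP[].
have IG z : z \in I -> z \in V /\ z \notin c.
  move/(subsetP sI); rewrite in_setD => /andP[zC zV]; split=> //.
  by apply: contra zC => /(mem_cyc_verts cy).
have dIS : [disjoint I & S].
  rewrite disjoint_subset; apply/subsetP => z /IG[_ zc]; rewrite !inE.
  by apply: contra zc => /Sc.
exists (I :|: S); split.
- exact: setUSS.
- apply: independentU => // u v /IG[uV uc] /Sc vc; apply: contra uc => uv.
  by apply: nbc vc uV _; rewrite e_sym.
- rewrite card_setU_disjoint // ES.
  by have := indep_num_cover e (subxx (Gam V :|: K :\ x)); lia.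
move=> u v; rewrite in_setU => /orP[uI|uS] /setDP[vC vK].
  exact: nI.
apply: contra vK => uv; rewrite inE; apply: nbc uv; first exact: Sc.
exact: (subsetP (cyc_verts_sub V)).
Qed.

End Structure.

(* The skew-rank enters the argument only through the properties assumed here;
   [good] stands for being odd or evenly-oriented. *)
Section AbstractRank.
Variables (T : finType) (e : rel T) (rk : {set T} -> nat) (good : seq T -> Prop).
Hypotheses (e_sym : symmetric e) (e_irr : irreflexive e).
Local Notation alpha V := (indep_num V e).
Local Notation C := (cyc_verts e).
Local Notation Gam := (tree_verts e).
Local Notation cyc := (cyc e).
Local Notation nbrs := (nbrs e).
Local Notation cyclo := (cyclo e).
Local Notation excess := (excess e).
Implicit Types (V : {set T}) (c : seq T) (x y : T).

Hypothesis rk_set0 : rk set0 = 0.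
Hypothesis rk_mono : forall V y, rk (V :\ y) <= rk V.
Hypothesis rk_le : forall V y, rk V <= rk (V :\ y) + 2.
Hypothesis rk_isolated : forall V x, nbrs V x = set0 -> rk V = rk (V :\ x).
Hypothesis rk_pendant : forall V x y, x \in V -> nbrs V x = [set y] ->
  rk V = rk (V :\ x :\ y) + 2.
Hypothesis rk_isolated_cycle : forall V c x, cyc V c ->
  (forall v, v \in c -> cycle_nbrs e V c v) -> x \in c ->
  rk V <= rk (V :\ x) <-> good c.
Hypothesis rk_pendant_cycle : forall V c b y, cyc V c -> b \in c -> y \notin c ->
  nbrs V b = y |: [set next c b; prev c b] ->
  (forall v, v \in c -> v != b -> cycle_nbrs e V c v) ->
  good c -> rk (V :\ y) + 2 <= rk V.
Hypothesis rk_pendant_cycle_good : forall V c b y, cyc V c -> b \in c -> y \notin c ->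
  nbrs V b = y |: [set next c b; prev c b] ->
  (forall v, v \in c -> v != b -> cycle_nbrs e V c v) ->
  rk V <= rk (V :\ b) -> good c.

(** * Removal of end blocks and the lower bound *)

Lemma alpha_del_le V x : alpha (V :\ x) <= alpha V.
Proof. exact/indep_num_mono/subsetDl. Qed.

Lemma card_del V x : x \in V -> #|V| = #|V :\ x| + 1.
Proof. by move=> xV; rewrite (cardsD1 x) xV addnC. Qed.

Lemma alpha_isolated V x : x \in V -> nbrs V x = set0 -> alpha V = alpha (V :\ x) + 1.
Proof.
move=> xV nx; apply/eqP; rewrite eqn_leq addn1 indep_num_del /= -add1n.
have h : 1 <= alpha [set x].
  rewrite -(cards1 x); apply: indep_num_ge => //.
  by apply/independentP => u v /set1P-> /set1P->; rewrite e_irr.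
apply: leq_trans (leq_add h (leqnn _)) _; apply: indep_num_join; first exact: e_sym.
- by rewrite subUset sub1set xV subsetDl.
- by rewrite disjoints1 !inE eqxx.
move=> u v /set1P->; rewrite !inE => /andP[_ vV]; apply/negP => xv.
by have := in_set0 v; rewrite -nx inE vV xv.
Qed.

Lemma alpha_pendant V x y : x \in V -> nbrs V x = [set y] ->
  alpha V = alpha (V :\ x :\ y) + 1.
Proof.
move=> xV nx; have [yV xy] : y \in V /\ e x y by apply/nbrsP; rewrite nx set11.
apply/eqP; rewrite eqn_leq addn1 indep_num_del_edge //= -addn1.
have yx : y != x by apply: contraTneq xy => ->; rewrite e_irr.
have E : V :\ x :\ y = V :\ y :\ x by rewrite setDDl setUC -setDDl.
rewrite E -alpha_isolated ?alpha_del_le //; first by rewrite !inE eq_sym yx.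
apply/setP => z; rewrite !inE; apply/negP => /andP[/andP[zy zV] xz].
by have := in_set1 z y; rewrite -nx inE zV xz (negPf zy).
Qed.

Lemma cyclo_isolated V x : x \in V -> nbrs V x = set0 -> cyclo V = cyclo (V :\ x).
Proof.
move=> xV nx; rewrite (cyclo_del e_sym e_irr xV) excessE nx cards0 sub0n addn0 //.
Qed.

Lemma cyclo_pendant V x y : x \in V -> nbrs V x = [set y] ->
  cyclo V = cyclo (V :\ x :\ y) + excess (V :\ x) y.
Proof.
move=> xV nx; have [yV xy] : y \in V /\ e x y by apply/nbrsP; rewrite nx set11.
have yx : y != x by apply: contraTneq xy => ->; rewrite e_irr.
have -> : cyclo V = cyclo (V :\ x).
  by rewrite (cyclo_del e_sym e_irr xV) excessE /touched nx imset_set1 !cards1 addn0.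
by apply: (cyclo_del e_sym e_irr); rewrite !inE yx.
Qed.

Lemma card_pendant V x y : x \in V -> nbrs V x = [set y] -> #|V| = #|V :\ x :\ y| + 2.
Proof.
move=> xV nx; have [yV xy] : y \in V /\ e x y by apply/nbrsP; rewrite nx set11.
have yx : y != x by apply: contraTneq xy => ->; rewrite e_irr.
by rewrite (card_del xV) (card_del (V := V :\ x) (x := y)) ?inE ?yx // -addnA.
Qed.

Lemma excess_on_cyc V c x : cyc V c -> x \in c -> 0 < excess V x.
Proof.
move=> cy xc; rewrite lt0n; apply/eqP => /(excess0P e_sym e_irr (cyc_sub cy xc)).
by apply; exists c.
Qed.

(** Deleting a vertex of positive excess costs 2 on the left and at least 2 in [2 * cyclo]. If there
    is none, the graph is a forest, so its end block is an isolated or pendant vertex. *)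
Theorem skew_rank_ge V : 2 * #|V| <= rk V + 2 * alpha V + 2 * cyclo V.
Proof.
have [m] := ubnP #|V|; elim: m V => // m IH V ltm.
have [->|V0] := eqVneq V set0; first by rewrite cards0.
have [/existsP[x /andP[xV ex]]|noex] := boolP [exists x, (x \in V) && (0 < excess V x)].
  have cV := card_del xV; have := IH (V :\ x) ltac:(lia).
  have := rk_mono V x; have := alpha_del_le V x.
  by rewrite (cyclo_del e_sym e_irr xV); lia.
have ex0 x : x \in V -> excess V x = 0.
  move=> xV; apply/eqP; rewrite -leqn0 leqNgt; apply: contra noex => ex.
  by apply/existsP; exists x; rewrite xV.
have : end_block e V.
  by apply: (ex_end_block e_sym e_irr) => // x /ex0 ->.
case=> [x xV nx|x y xV nx|c cy _|c b y cy bc _ _ _].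
- have cV := card_del xV; have := IH (V :\ x) ltac:(lia).
  by rewrite (rk_isolated nx) (alpha_isolated xV nx) (cyclo_isolated xV nx); lia.
- have cV := card_pendant xV nx; have := IH (V :\ x :\ y) ltac:(lia).
  by rewrite (rk_pendant xV nx) (alpha_pendant xV nx) (cyclo_pendant xV nx); lia.
- case: c cy => // x c cy; have := excess_on_cyc cy (mem_head _ _).
  by rewrite ex0 // (cyc_sub cy (mem_head _ _)).
- by have := excess_on_cyc cy bc; rewrite ex0 // (cyc_sub cy bc).
Qed.

(** * The case of equality *)

Definition tight V := rk V + 2 * alpha V + 2 * cyclo V <= 2 * #|V|.

(** The lower bound for [V :\ x] leaves no slack, so every inequality in the deletion step is an
    equality. *)
Lemma tight_del V x : tight V -> x \in V -> 0 < excess V x ->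
  [/\ excess V x = 1, tight (V :\ x), rk V = rk (V :\ x) & alpha V = alpha (V :\ x)].
Proof.
rewrite /tight => tV xV ex; have := skew_rank_ge (V :\ x).
have := card_del xV; have := rk_mono V x; have := alpha_del_le V x.
by move: tV; rewrite (cyclo_del e_sym e_irr xV) => *; split; lia.
Qed.

Lemma structured_tight V : structured e good V -> tight V.
Proof.
have [m] := ubnP #|V|; elim: m V => // m IH V ltm sV.
have [V0|V0] := eqVneq V set0.
  have := cyclo0 e; have := rk_set0; have := indep_num_card e set0; rewrite /tight V0 cards0; lia.
have D := st_disjoint sV.
(* Deleting a tree vertex adjacent to a cycle keeps [alpha] and [cyclo] and lowers the rank by at
   most 2, so tightness passes back from [V :\ y]. *)
have [/existsP[y /existsP[z /and3P[yG zC yz]]]|noGC] := boolP [exists y, exists z,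
    [&& y \in Gam V, z \in C V & e y z]].
  have [sy le] := structured_del_nbr e_sym sV yG zC yz.
  have /setDP[yV yC] := yG; have cV := card_del yV.
  have := IH (V :\ y) ltac:(lia) sy; have := rk_le V y.
  by rewrite /tight (cyclo_del e_sym e_irr yV) (excess_eq e_sym e_irr) // (negPf yC); lia.
have nGC y z : y \in Gam V -> z \in C V -> ~~ e y z.
  move=> yG zC; apply: contra noGC => yz; apply/existsP; exists y; apply/existsP.
  by exists z; rewrite yG zC.
(* Every cycle is now a component; deleting one of its vertices keeps rank and [alpha] and lowers
   [cyclo] by one. *)
have [C0|[x xC]] := set_0Vmem (C V); last first.
  have /cyc_vertsP[c cy xc] := xC; have xV := cyc_sub cy xc.
  have nb := structured_cycle_nbrs e_sym e_irr sV nGC cy.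
  have sx := structured_del_cycle e_sym sV nb cy xc.
  have cV := card_del xV; have := IH (V :\ x) ltac:(lia) sx.
  have := alpha_rot e_sym cy nb xc.
  have : rk V <= rk (V :\ x).
    exact/(rk_isolated_cycle cy nb xc)/(st_good sV).
  rewrite /tight (cyclo_del e_sym e_irr xV) (excess_eq e_sym e_irr) // xC; lia.
(* In the remaining forest, the end blocks are isolated or pendant vertices, whose removal stays
   acyclic. *)
have C0' x : x \in V -> C (V :\ x) = set0.
  by move=> xV; rewrite cyc_verts_del_tree ?C0 ?inE.
have : end_block e V.
  apply: (ex_end_block e_sym e_irr) => // x xV.
  by rewrite (excess_eq e_sym e_irr) // C0 inE.
have nocyc c x : cyc V c -> x \notin c.
  by move=> cy; apply/negP => /(mem_cyc_verts cy); rewrite C0 inE.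
case=> [x xV nx|x y xV nx|c cy _|c b y cy bc _ _ _].
- have cV := card_del xV.
  have := IH (V :\ x) ltac:(lia) (structured_acyclic _ (C0' _ xV)).
  by rewrite /tight (rk_isolated nx) (alpha_isolated xV nx) (cyclo_isolated xV nx); lia.
- have cV := card_pendant xV nx.
  have [yV xy] : y \in V /\ e x y by apply/nbrsP; rewrite nx set11.
  have yx : y != x by apply: contraTneq xy => ->; rewrite e_irr.
  have yVx : y \in V :\ x by rewrite !inE yx.
  have Dx := disjoint_del (x := x) D.
  have C0y : C (V :\ x :\ y) = set0 by rewrite cyc_verts_del_tree C0' ?inE.
  have := IH (V :\ x :\ y) ltac:(lia) (structured_acyclic _ C0y).
  rewrite /tight (rk_pendant xV nx) (alpha_pendant xV nx) (cyclo_pendant xV nx).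
  by rewrite (excess_eq e_sym e_irr) // C0' // inE; lia.
- by case: c cy => // z c cy; have := nocyc _ z cy; rewrite mem_head.
- by have := nocyc _ b cy; rewrite bc.
Qed.

Lemma tight_structured V : tight V -> structured e good V.
Proof.
have [m] := ubnP #|V|; elim: m V => // m IH V ltm tV.
have ex1 x : x \in V -> excess V x <= 1.
  move=> xV; case: (posnP (excess V x)) => [->//|ex].
  by have [-> _ _ _] := tight_del tV xV ex.
have D := excess_disjoint e_sym e_irr ex1.
have [V0|V0] := eqVneq V set0.
  apply: structured_acyclic; apply/eqP; rewrite -subset0 -V0; exact: cyc_verts_sub.
(* Deleting any cycle vertex stays tight, so the induction hypothesis applies, and neither the rank
   nor [alpha] changes. *)
have on_tight c x : cyc V c -> x \in c ->
   [/\ structured e good (V :\ x), rk V = rk (V :\ x) & alpha V = alpha (V :\ x)].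
  move=> cy xc; have xV := cyc_sub cy xc.
  have [_ tx -> ->] := tight_del tV xV (excess_on_cyc cy xc).
  by split=> //; apply: IH tx; have := card_del xV; lia.
case: (ex_end_block e_sym e_irr ex1 V0) => [x xV nx|x y xV nx|c cy nb|c b y cy bc yc nb nbv].
- apply: (structured_add_isolated e_sym e_irr xV nx); have cV := card_del xV.
  apply: IH; first by lia.
  move: tV; rewrite /tight (rk_isolated nx) (alpha_isolated xV nx) (cyclo_isolated xV nx); lia.
- have cV := card_pendant xV nx; have := skew_rank_ge (V :\ x :\ y).
  have := tV; rewrite /tight (rk_pendant xV nx) (alpha_pendant xV nx) (cyclo_pendant xV nx).
  move=> tV' ge; have [yV xy] : y \in V /\ e x y by apply/nbrsP; rewrite nx set11.
  have yx : y != x by apply: contraTneq xy => ->; rewrite e_irr.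
  have yVx : y \in V :\ x by rewrite !inE yx.
  apply: (structured_add_pendant e_sym e_irr xV nx); last by apply: IH; rewrite /tight; lia.
  (* The lower bound for the graph without [x] and [y] leaves no room for a positive excess of [y].
     So [y] lies on no cycle of [V :\ x], nor of [V], since [x] has only one neighbour. *)
  have /(excess0P e_sym e_irr yVx) ny : excess (V :\ x) y = 0 by lia.
  apply/negP => /cyc_vertsP[c cy yc]; apply: ny; exists c => //; rewrite cyc_delE cy andbT.
  apply/negP => xc; have := cyc_next_neq_prev cy xc.
  have := cyc_next cy xc; have := cyc_prev e_sym cy xc.
  by rewrite nx !inE => /eqP-> /eqP->; rewrite eqxx.
- have [x xc] : exists x, x \in c.
    by case: c cy {nb} => // x c _; exists x; rewrite mem_head.
  have [sx _ _] := on_tight c x cy xc.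
  (* Since [good] is a predicate on sequences, it is proved for every cycle [c'] through [x]; each
     has the same edges as [c]. *)
  apply: (structured_add_cycle e_sym D cy xc nb _ sx) => c' cy' xc'.
  have [_ Er _] := on_tight c' x cy' xc'.
  have nb' v : v \in c' -> cycle_nbrs e V c' v.
    move=> vc'; have vc : v \in c by rewrite (disjoint_mem D cy cy' xc xc').
    have := D c c' x cy cy' xc xc' v => E; rewrite /cycle_nbrs nb //; apply/setP => z.
    have := E z; rewrite (cyc_edgeE _ cy) // (cyc_edgeE _ cy') //.
    by rewrite !inE.
  by apply/(rk_isolated_cycle cy' nb' xc'); rewrite Er.
have [sb Er _] := on_tight c b cy bc.
have [yV _] : y \in V /\ e b y by apply/nbrsP; rewrite nb setU11.
(* Deleting [b] keeps the rank, which forces the cycle to be good; then deleting [y] lowers the rank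
   by 2. *)
have ry : rk (V :\ y) + 2 <= rk V.
  apply: (rk_pendant_cycle cy bc yc nb nbv).
  by apply: (rk_pendant_cycle_good cy bc yc nb nbv); rewrite Er.
(* Deleting a cycle vertex would have kept the rank, contrary to [ry]. *)
have yC : y \notin C V.
  apply/negP => /cyc_vertsP[c' cy' yc']; have [_ Ey _] := on_tight c' y cy' yc'.
  by move: ry; lia.
have cV := card_del yV; have := skew_rank_ge (V :\ y); have := alpha_del_le V y.
have := tV; rewrite /tight (cyclo_del e_sym e_irr yV) (excess_eq e_sym e_irr) // (negPf yC).
move=> tV' ale ge.
apply: (structured_add_pendant_cycle e_sym D cy bc yc nb nbv yC _ sb); last by lia.
by apply: IH; rewrite /tight; lia.
Qed.


End AbstractRank.

(** * Contraction of the cycles *)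

Section Contraction.
Variables (T : finType) (e : rel T).
Hypotheses (e_sym : symmetric e) (e_irr : irreflexive e).
Implicit Types (V K : {set T}) (c : seq T) (x y : T).
Local Notation cyc := (cyc e).
Local Notation induced := (induced e).
Local Notation C := (cyc_verts e).
Local Notation Gam := (tree_verts e).
Local Notation alpha V := (indep_num V e).

Definition cycle_class V x := [set y | on_common_cycle (induced V) x y].
Definition cycle_classes V := [set cycle_class V x | x in C V].

Lemma cycle_classE V c x : disjoint_cyc e V -> cyc V c -> x \in c ->
  cycle_class V x = [set z in c].
Proof.
move=> D cy xc; apply/setP => y; rewrite !inE.
apply/on_common_cycleP/idP => [[c' [cy' xc' yc']]|yc]; last by exists c.
by rewrite (disjoint_mem D cy cy' xc xc').
Qed.

Lemma cycle_classesP V K : disjoint_cyc e V ->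
  reflect (exists2 c, cyc V c & K = [set z in c]) (K \in cycle_classes V).
Proof.
move=> D; apply: (iffP imsetP) => [[x /cyc_vertsP[c cy xc] ->]|[c cy ->]].
  by exists c => //; apply: cycle_classE.
have [x xc] : exists x, x \in c by case: c cy => // x c _; exists x; rewrite mem_head.
by exists x; [apply: mem_cyc_verts xc|rewrite (cycle_classE D cy xc)].
Qed.

(** Deleting a cycle vertex removes exactly one class and has excess 1; deleting any other vertex
    changes neither count. *)
Lemma cyclo_classes V : disjoint_cyc e V -> cyclo e V = #|cycle_classes V|.
Proof.
elim/set_ind_del: V => [|V x xV IH] D.
  rewrite cyclo0; apply/esym/eqP; rewrite cards_eq0; apply/eqP/setP => K.
  rewrite in_set0; apply/negP => /(cycle_classesP _ D)[[|x c] cy] // _.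
  by have := cyc_sub cy (mem_head x c); rewrite inE.
have Dx := disjoint_del (x := x) D.
rewrite (cyclo_del e_sym e_irr xV) (excess_eq e_sym e_irr) // IH //.
have [/cyc_vertsP[c0 cy0 xc0]|xC] := boolP (x \in C V); last first.
  rewrite addn0; congr #|pred_of_set _|; apply/setP => K.
  apply/cycle_classesP/cycle_classesP => // -[c cy ->]; exists c => //.
    by rewrite cyc_del_tree in cy.
  by rewrite cyc_del_tree.
have -> : cycle_classes V = [set z in c0] |: cycle_classes (V :\ x).
  apply/setP => K; rewrite in_setU1.
  apply/cycle_classesP/orP => // [[c cy ->]|[/eqP->|]].
  - have [xc|xc] := boolP (x \in c).
      by left; apply/eqP/setP => z; rewrite !inE (disjoint_mem D cy cy0 xc xc0).
    by right; apply/cycle_classesP => //; exists c => //; rewrite cyc_delE xc.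
  - by exists c0.
  by case/(cycle_classesP _ Dx) => c; rewrite cyc_delE => /andP[_ cy] ->; exists c.
rewrite cardsU1 addnC; congr (_ + _).
rewrite (_ : _ \notin _) //; apply/negP => /(cycle_classesP _ Dx)[c].
rewrite cyc_delE => /andP[xc _] /setP/(_ x); rewrite !inE xc0.
by rewrite (negPf xc).
Qed.

Lemma cyc_setT c : cyc setT c = is_cycle e c.
Proof.
rewrite cycE (eq_cycle (e' := e)) // => x y.
by rewrite inducedE !inE.
Qed.

Lemma disjoint_setT : cycles_vertex_disjoint e <-> disjoint_cyc e setT.
Proof.
split=> [H c1 c2 x|D c1 c2]; last first.
  rewrite -!cyc_setT => cy1 cy2; rewrite disjoint_has.
  have [/hasP[x x1 x2]|] := boolP (has _ _); last by left.
  by right; apply: (D _ _ x).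
rewrite !cyc_setT => cy1 cy2 x1 x2; have [|//] := H c1 c2 cy1 cy2.
by rewrite disjoint_has => /hasP[]; exists x.
Qed.

Lemma on_common_cycle_setT x y :
  on_common_cycle (induced setT) x y = on_common_cycle e x y.
Proof.
by apply/on_common_cycleP/on_common_cycleP => -[c [cy xc yc]]; exists c;
  rewrite -?cyc_setT // in cy *; rewrite cyc_setT in cy.
Qed.

Lemma Gamma_setT : Gamma_vertices e = Gam setT.
Proof. by apply/setP => x; rewrite !inE /on_cycle on_common_cycle_setT andbT. Qed.

Lemma contr_class_cyc x : x \in C setT -> contr_class e x = cycle_class setT x.
Proof.
move=> xC; apply/setP => y; rewrite !inE on_common_cycle_setT.
by have [->|//] := eqVneq y x; move: xC; rewrite inE on_common_cycle_setT => ->.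
Qed.

Lemma contr_class_tree x : x \in Gam setT -> contr_class e x = [set x].
Proof.
move=> xG; apply/setP => y; rewrite !inE; case: eqP => //= _.
apply: contraTF xG => /on_common_cycleP[c [cy xc _]].
by rewrite in_setD (mem_cyc_verts (V := setT) (c := c)) // cyc_setT.
Qed.

Lemma mem_setT_cover x : (x \in C setT) || (x \in Gam setT).
Proof. by rewrite in_setD in_setT andbT orbN. Qed.

Lemma cycle_class_id V x : x \in C V -> x \in cycle_class V x.
Proof. by rewrite !inE. Qed.

Lemma TG_vertices_sub : cycle_classes setT \subset TG_vertices e.
Proof.
by apply/subsetP => K /imsetP[x xC ->]; rewrite -contr_class_cyc // imset_f.
Qed.

Lemma TG_adjI (A B : {set T}) x y : A != B -> x \in A -> y \in B -> e x y -> TG_adj e A B.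
Proof.
move=> AB xA yB xy; rewrite /TG_adj AB; apply/exists_inP; exists x => //.
by apply/exists_inP; exists y.
Qed.

Definition tree_part (S : {set {set T}}) := [set x in Gam setT | [set x] \in S].

(** A vertex of the contracted graph is either a cycle class or the singleton of a tree vertex. *)
Lemma tree_part_card (S : {set {set T}}) : S \subset TG_vertices e ->
  #|S| <= #|S :&: cycle_classes setT| + #|tree_part S|.
Proof.
move=> sS; rewrite -(cardsID (cycle_classes setT) S) leq_add2l.
apply: leq_trans (leq_imset_card (fun x => [set x]) _); apply: subset_leq_card.
apply/subsetP => K /setDP[KS Kc]; have /imsetP[x _ EK] := subsetP sS _ KS.
have xG : x \in Gam setT.
  case/orP: (mem_setT_cover x) => // xC.
  by rewrite EK contr_class_cyc // imset_f in Kc.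
rewrite EK contr_class_tree // in KS *; apply: imset_f; by rewrite inE xG.
Qed.

Lemma tree_part_indep (S : {set {set T}}) : independent (TG_adj e) S ->
  independent e (tree_part S).
Proof.
move/independentP => iS; apply/independentP => x y.
rewrite !inE => /andP[_ xS] /andP[_ yS]; apply: contra (iS _ _ xS yS) => xy.
apply: (TG_adjI (x := x) (y := y)); rewrite ?set11 //.
by rewrite (inj_eq set1_inj); apply: contraTneq xy => ->; rewrite e_irr.
Qed.

Lemma tree_part_sub S : tree_part S \subset Gam setT.
Proof. by apply/subsetP => x; rewrite inE => /andP[]. Qed.

Variable good : seq T -> Prop.

(** For disjoint cycles the independence number of the contraction is at most that of the tree part
    plus the number of cycles. Equality means that some maximum independent set consists of all
    cycle classes and of a maximum independent set of the tree part, with no adjacency within or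
    between the two. *)
Lemma structured_setT : structured e good setT <->
  [/\ cycles_vertex_disjoint e, forall c, is_cycle e c -> good c &
      indep_num (TG_vertices e) (TG_adj e) = alpha (Gamma_vertices e) + cyclo e setT].
Proof.
rewrite Gamma_setT; split=> [[D Gd A [I [sI iI cI nI]]]|[/disjoint_setT D Gd]].
  split; [exact/disjoint_setT|by move=> c; rewrite -cyc_setT; apply: Gd|].
  rewrite cyclo_classes //; apply/eqP; rewrite eqn_leq; apply/andP; split.
    have [S [sS iS <-]] := indep_num_ex (TG_adj e) (TG_vertices e).
    apply: leq_trans (tree_part_card sS) _; rewrite addnC; apply: leq_add.
      exact: indep_num_ge (tree_part_sub S) (tree_part_indep iS).
    by apply: subset_leq_card; apply: subsetIr.
  (* The witness is [J] together with all cycle classes; [st_apart] makes distinct classes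
     non-adjacent. *)
  pose J := [set [set x] | x in I].
  have IG x : x \in I -> x \in Gam setT by apply: (subsetP sI).
  have JC : [disjoint J & cycle_classes setT].
    rewrite disjoint_subset; apply/subsetP => K /imsetP[x xI ->]; rewrite inE.
    apply/negP => /imsetP[z zC /setP/(_ z)]; rewrite (cycle_class_id zC) inE.
    by move/eqP => zx; move/IG: xI; rewrite in_setD -zx zC.
  have cJ : #|J| = #|I| by rewrite card_imset //; apply: set1_inj.
  apply: leq_trans (leq_add cI (leqnn _)) _; rewrite -cJ -(card_setU_disjoint JC).
  apply: indep_num_ge.
    rewrite subUset TG_vertices_sub andbT; apply/subsetP => K /imsetP[x xI ->].
    by rewrite -contr_class_tree ?IG // imset_f.
  have TG_sym : symmetric (TG_adj e).
    move=> P Q; rewrite /TG_adj eq_sym; congr (_ && _).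
    by apply/exists_inP/exists_inP => -[x xP /exists_inP[y yQ xy]]; exists y => //;
      apply/exists_inP; exists x; rewrite // e_sym.
  apply: independentU => //.
  - apply/independentP => _ _ /imsetP[x xI ->] /imsetP[y yI ->].
    apply/negP => /andP[_ /exists_inP[u /set1P-> /exists_inP[v /set1P-> xy]]].
    by have /independentP/(_ _ _ xI yI) := iI; rewrite xy.
  - apply/independentP => _ _ /imsetP[x xC ->] /imsetP[y yC ->].
    apply/negP => /andP[ne /exists_inP[u ux /exists_inP[v vy uv]]].
    rewrite !inE in ux vy.
    have [c1 [cy1 x1 u1]] := on_common_cycleP _ _ _ ux.
    have [c2 [cy2 y2 v2]] := on_common_cycleP _ _ _ vy.
    have uC : u \in C setT by apply: mem_cyc_verts u1.
    have vC : v \in C setT by apply: mem_cyc_verts v2.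
    have [c [cy uc vc]] := A _ _ uC vC uv; case/eqP: ne.
    rewrite (cycle_classE D cy1 x1) (cycle_classE D cy2 y2); apply/setP => z; rewrite !inE.
    by rewrite (disjoint_mem D cy1 cy u1 uc) (disjoint_mem D cy2 cy v2 vc).
  - move=> _ _ /imsetP[x xI ->] /imsetP[y yC ->].
    apply/negP => /andP[_ /exists_inP[u /set1P-> /exists_inP[v vy xv]]].
    rewrite inE in vy; have [c2 [cy2 y2 v2]] := on_common_cycleP _ _ _ vy.
    by have := nI x v xI (mem_cyc_verts cy2 v2); rewrite xv.
rewrite cyclo_classes // => Eq.
have [S [sS iS ES]] := indep_num_ex (TG_adj e) (TG_vertices e).
have h1 := tree_part_card sS.
have h2 := indep_num_ge (tree_part_sub S) (tree_part_indep iS).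
have h3 : #|S :&: cycle_classes setT| <= #|cycle_classes setT|.
  by apply: subset_leq_card; apply: subsetIr.
(* A sum attaining its upper bound attains it in each term: all cycle classes occur in [S], and its
   singletons form a maximum independent set of the tree part. *)
have tight_sum a k s t : a + k <= s + t -> t <= a -> s <= k -> k <= s /\ a <= t by lia.
rewrite ES Eq in h1; have [h4 h5] := tight_sum _ _ _ _ h1 h2 h3.
have clS : cycle_classes setT \subset S.
  by apply/setIidPr/eqP; rewrite eqEcard subsetIr.
move/independentP: (iS) => iS'.
split=> //; first by move=> c; rewrite cyc_setT; apply: Gd.
- move=> x y xC yC xy.
  have xS : cycle_class setT x \in S by apply: (subsetP clS); apply: imset_f.
  have yS : cycle_class setT y \in S by apply: (subsetP clS); apply: imset_f.
  have Exy : cycle_class setT x = cycle_class setT y.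
    apply/eqP; apply: contraNT (iS' _ _ xS yS) => ne.
    by apply: (TG_adjI (x := x) (y := y)) => //; apply: cycle_class_id.
  by have := cycle_class_id yC; rewrite -Exy inE => /on_common_cycleP.
exists (tree_part S); split; [exact: tree_part_sub|exact: tree_part_indep|exact: h5|].
move=> x y; rewrite inE => /andP[xG xS] yC.
have yS : cycle_class setT y \in S by apply: (subsetP clS); apply: imset_f.
apply: contra (iS' _ _ xS yS) => xy.
apply: (TG_adjI (x := x) (y := y)); rewrite ?set11 ?cycle_class_id //.
apply: contraTneq xy => E; have := cycle_class_id yC; rewrite -E inE => /eqP->.
by rewrite e_irr.
Qed.

Lemma dimcyc_connected : 0 < #|T| -> (forall x y, connect e x y) ->
  dimcyc e = Posz (cyclo e setT).
Proof.
move=> /card_gt0P[x0 _] co.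
have co' x y : connect (induced setT) x y.
  by rewrite (eq_connect (e' := e)) // => u v; rewrite inducedE !inE.
have c1 : #|components e setT| = 1.
  rewrite (_ : components e setT = [set component e setT x0]) ?cards1 //.
  apply/setP => K; rewrite inE; apply/imsetP/eqP => [[x _ ->]|->]; last by exists x0.
  by apply/eqP; rewrite comp_eq.
have n1 : num_comp e = 1.
  (* [num_comp] counts the components of the relation [connect e], hence the nested [connect]. *)
  rewrite /num_comp (eq_n_comp_r (a' := connect (connect e) x0)).
    apply: n_comp_connect; apply: sym_connect_sym => x y; by rewrite !co.
  by move=> y; rewrite /in_mem /= connect1.
have E : num_edges e = #|edges e setT|.
  by congr #|pred_of_set _|; apply/setP => p; rewrite !inE.
have := cyclo_ge e_sym e_irr setT; rewrite /dimcyc /cyclo n1 E c1 cardsT.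
set k := #|edges e setT|; lia.
Qed.

End Contraction.

Lemma map_next (T : eqType) (c : seq T) : uniq c -> map (next c) c = rot 1 c.
Proof.
case: c => // y c u; rewrite rot1_cons.
apply: (@eq_from_nth _ y); first by rewrite size_map size_rcons.
move=> i; rewrite size_map => ic; rewrite (nth_map y) // next_nth mem_nth //.
by rewrite index_uniq // nth_rcons_default.
Qed.

Import Order.TTheory GRing.Theory Num.Theory.
Local Open Scope ring_scope.

(** * Ranks of skew-symmetric matrices *)

Section SkewRank.
Variables (F : numFieldType) (n : nat).
Implicit Types (A S : 'M[F]_n) (V : {set 'I_n}).

(** A coordinate projection: conjugating by it deletes the vertex [y] while all matrices keep the
    size [n]. *)
Definition kill (y : 'I_n) : 'M[F]_n := 1%:M - delta_mx y y.
Definition mask V S : 'M[F]_n :=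
  \matrix_(i, j) (if (i \in V) && (j \in V) then S i j else 0).

Lemma tr_kill y : (kill y)^T = kill y.
Proof. by rewrite /kill linearB /= trmx1 trmx_delta. Qed.

Lemma killE y A i j : (kill y *m A) i j = if i == y then 0 else A i j.
Proof.
rewrite /kill mulmxBl mul1mx !mxE (bigD1 y) //= mxE eqxx andbT big1 => [|k ky].
  by rewrite addr0; case: eqP => [->|_]; rewrite ?mul1r ?subrr ?mul0r ?subr0.
by rewrite mxE (negPf ky) andbF mul0r.
Qed.

Lemma mulmx_kill y A i j : (A *m kill y) i j = if j == y then 0 else A i j.
Proof. by rewrite -[A *m _]trmxK trmx_mul tr_kill mxE killE mxE. Qed.

Lemma mask_del V y S : mask (V :\ y) S = kill y *m mask V S *m kill y.
Proof.
apply/matrixP => i j; rewrite mulmx_kill killE !mxE !inE.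
by case: eqP => //= _; case: eqP => //=; rewrite ?andbF //=; case: (_ \in _).
Qed.

Lemma tr_mask V S : S^T = - S -> (mask V S)^T = - mask V S.
Proof.
move=> sk; apply/matrixP => i j; rewrite !mxE andbC.
by case: ifP => _; rewrite ?oppr0 //; have := congr1 (fun M : 'M_n => M i j) sk; rewrite !mxE.
Qed.

Lemma mask_setT S : mask setT S = S.
Proof. by apply/matrixP => i j; rewrite mxE !inE. Qed.

Lemma mask_isolated V x S : (forall y, y \in V -> S x y = 0 /\ S y x = 0) ->
  mask V S = mask (V :\ x) S.
Proof.
move=> H; apply/matrixP => i j; rewrite !mxE !inE.
have [->|_] := eqVneq i x => /=.
  by case: ifP => // /andP[_ jV]; case: (H _ jV).
have [->|_] := eqVneq j x => /=; last by [].
by rewrite andbF; case: ifP => // /andP[iV _]; case: (H _ iV).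
Qed.

Lemma rank_kill_le y A : (\rank (kill y *m A *m kill y) <= \rank A)%N.
Proof. exact: leq_trans (mxrankM_maxl _ _) (mxrankM_maxr _ _). Qed.

(** The two matrices differ by a sum of two products, each having the rank-one factor
    [delta_mx y y]. *)
Lemma rank_le_kill y A : (\rank A <= \rank (kill y *m A *m kill y) + 2)%N.
Proof.
pose P := kill y; pose d : 'M[F]_n := delta_mx y y.
have E : A = P *m A *m P + (d *m A + P *m A *m d).
  have one : 1%:M = P + d by rewrite /P /kill subrK.
  rewrite addrCA -mulmxDr -one mulmx1 -mulmxDl addrC -one mul1mx //.
have rd : \rank d = 1%N := mxrank_delta _ _ _.
rewrite {1}E; apply: leq_trans (mxrank_add _ _) _; rewrite leq_add2l.
apply: leq_trans (mxrank_add _ _) _; apply: (@leq_add _ _ 1 1).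
  by apply: leq_trans (mxrankM_maxl _ _) _; rewrite rd.
by apply: leq_trans (mxrankM_maxr _ _) _; rewrite rd.
Qed.

(** The matrix [K] fixes [A] because [w *m A = 0], and it kills the coordinate [x], so
    [K *m kill x = K]. Hence [A] is recovered from its compression by multiplying with [K] and its
    transpose. *)
Lemma rank_kill_kernel x A (w : 'rV[F]_n) : A^T = - A -> w *m A = 0 -> w 0 x != 0 ->
  (\rank A <= \rank (kill x *m A *m kill x))%N.
Proof.
move=> sk wA wx; pose K : 'M[F]_n := 1%:M - (w 0 x)^-1 *: (delta_mx x (0 : 'I_1) *m w).
have KA : K *m A = A by rewrite mulmxBl mul1mx -scalemxAl -mulmxA wA mulmx0 scaler0 subr0.
have KP : K *m kill x = K.
  rewrite /kill mulmxBr mulmx1; apply/eqP; rewrite subr_eq addrC -subr_eq subrr eq_sym.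
  apply/eqP; rewrite mulmxBl mul1mx -scalemxAl -mulmxA.
  have -> : w *m delta_mx x x = w 0 x *: delta_mx 0 x.
    apply/rowP => j; rewrite !mxE (bigD1 x) //= mxE eqxx big1 => [|k kx].
      by rewrite addr0.
    by rewrite mxE (negPf kx) mulr0.
  by rewrite -scalemxAr mul_delta_mx scalerA mulVf // scale1r subrr.
have AK : A *m K^T = A.
  by apply: oppr_inj; rewrite -mulNmx -sk -trmx_mul KA.
rewrite {1}(_ : A = K *m (kill x *m A *m kill x) *m K^T); last first.
  by rewrite !mulmxA KP -(mulmxA _ (kill x)) -{1}(tr_kill x) -trmx_mul KP KA AK.
exact: leq_trans (mxrankM_maxl _ _) (mxrankM_maxr _ _).
Qed.

(** The rows of the compressed matrix lie in the row space of [A] and in the kernel of [B], whereas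
    [A *m B] has rank 2; the rank formula for a product gives the gap of 2. *)
Lemma rank_kill_unit y A (w : 'rV[F]_n) : A^T = - A -> w *m A = delta_mx 0 y ->
  (\rank (kill y *m A *m kill y) + 2 <= \rank A)%N.
Proof.
move=> sk wA; set A' := _ *m kill y.
pose ey : 'rV[F]_n := delta_mx 0 y.
have Aw : A *m w^T = - ey^T by apply: oppr_inj; rewrite -mulNmx -sk -trmx_mul wA opprK.
(* The skew form of [A] vanishes on [w], so the entry of [w] at [y] is 0; cancelling the factor 2
   uses characteristic zero. *)
have wy : ey *m w^T = 0.
  have E : w *m A *m w^T = ey *m w^T by rewrite wA.
  have E2 : (w *m A *m w^T)^T = - (w *m A *m w^T).
    by rewrite !trmx_mul trmxK sk mulNmx mulmxN mulmxA.
  have : (ey *m w^T)^T = ey *m w^T.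
    by apply/matrixP => i j; rewrite [i]ord1 [j]ord1 mxE.
  rewrite -E E2 => /eqP; rewrite eq_sym -subr_eq0 opprK -mulr2n -scaler_nat.
  by rewrite scaler_eq0 pnatr_eq0 /= => /eqP.
have key : kill y *m ey^T = 0.
  rewrite /kill mulmxBl mul1mx trmx_delta mul_delta_mx subrr //.
have kw : kill y *m w^T = w^T.
  rewrite /kill mulmxBl mul1mx -(mul_delta_mx (0 : 'I_1)) -mulmxA.
  by rewrite -/ey wy mulmx0 subr0.
pose B := row_mx ey^T w^T.
have sub : (A' <= A :&: kermx B)%MS.
  rewrite sub_capmx; apply/andP; split.
    rewrite /A' /kill mulmxBr mulmx1; apply: addmx_sub; first exact: submxMl.
    rewrite eqmx_opp -(mul_delta_mx (0 : 'I_1)) mulmxA; apply: mulmx_sub.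
    by rewrite -wA submxMl.
  apply/sub_kermxP; rewrite /A' -[_ *m B]mulmxA mul_mx_row key kw -mulmxA.
  by rewrite mul_mx_row mulmx0 Aw mul_mx_row mulmxN key oppr0 mulmx0 row_mx0.
(* Multiplying by the rows [w] and [ey] gives a lower triangular 2 by 2 matrix with diagonal entries
   1 and -1. *)
have rk : (2 <= \rank (A *m B))%N.
  pose L := col_mx w ey.
  have : L *m (A *m B) = block_mx 1%:M 0 (ey *m A *m ey^T) (- 1%:M).
    rewrite mul_mx_row Aw mul_col_row; congr block_mx.
    - rewrite mulmxA wA /ey trmx_delta mul_delta_mx.
      by apply/matrixP => i j; rewrite [i]ord1 [j]ord1 !mxE.
    - by rewrite -[w]trmxK mulmxN -trmx_mul wy trmx0 oppr0.
    - by rewrite mulmxA.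
    - rewrite mulmxN /ey trmx_delta mul_delta_mx; congr (- _).
      by apply/matrixP => i j; rewrite [i]ord1 [j]ord1 !mxE.
  move=> E; apply: leq_trans (mxrankM_maxr L _); rewrite E.
  have U : block_mx 1%:M 0 (ey *m A *m ey^T) (- 1%:M) \in unitmx.
    by rewrite unitmxE det_lblock det1 mul1r -scaleN1r detZ det1 mulr1 expr1 unitrN1.
  by rewrite mxrank_unit.
rewrite -(mxrank_mul_ker A B) addnC; exact: leq_add rk (mxrankS sub).
Qed.

Lemma mask_rank_mono V y S : (\rank (mask (V :\ y) S) <= \rank (mask V S))%N.
Proof. by rewrite mask_del rank_kill_le. Qed.

Lemma mask_rank_le V y S : (\rank (mask V S) <= \rank (mask (V :\ y) S) + 2)%N.
Proof. by rewrite mask_del rank_le_kill. Qed.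


(** * Alternating vectors along a cycle *)

Section CycleVector.
Variables (A S : 'M[F]_n) (f : 'I_n -> 'I_n) (b : 'I_n) (tau : 'rV[F]_n).

(* The coefficients make the product with [A] telescope along the walk
   [x], [f x], [f (f x)], ..., leaving only its two ends and a multiple of [tau],
   the part of the row of [b] that points off the walk. *)
Fixpoint walk_vec m x : 'rV[F]_n :=
  if m is m'.+1 then
    S x (f x) *: delta_mx 0 (f x) +
    (S x (f x) * S (f x) (f (f x))) *: walk_vec m' (f (f x))
  else 0.

Variable D : pred 'I_n.
Hypothesis f_D : forall x, D x -> D (f x).

(** With [s = S x (f x)], the row of [f x] scaled by [s] contributes minus the unit vector at [x],
    as [s ^+ 2 = 1], and a multiple of the unit vector at [f (f x)] that cancels the start of the
    remaining walk. *)
Lemma walk_vec_mul m x :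
  (forall z, D z -> S z (f z) ^+ 2 = 1) ->
  (forall z, D z -> delta_mx 0 (f z) *m A =
     - S z (f z) *: delta_mx 0 z + S (f z) (f (f z)) *: delta_mx 0 (f (f z)) +
     (f z == b)%:R *: tau) -> D x ->
  walk_vec m x *m A =
    (\prod_(z <- traject f x m.*2) S z (f z)) *: delta_mx 0 (iter m.*2 f x)
    - delta_mx 0 x + walk_vec m x 0 b *: tau.
Proof.
move=> sq row; elim: m x => [|m IH] x Dx.
  by rewrite /= big_nil scale1r subrr mul0mx mxE scale0r addr0.
rewrite [walk_vec _ _]/= mulmxDl -!scalemxAl IH; last exact/f_D/f_D.
rewrite row // doubleS /= !big_cons -!iterS -!iterSr; apply/rowP => j.
have := sq x Dx; set s := S x (f x); set t := S (f x) (f (f x)) => ss.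
rewrite [(_ + _ : 'rV_n) 0 b]mxE ![(_ *: _ : 'rV_n) 0 b]mxE ![(_ + _ : 'rV_n) 0 j]mxE.
rewrite ![(_ *: _ : 'rV_n) 0 j]mxE ![(_ + _ : 'rV_n) 0 j]mxE.
rewrite ![(_ *: _ : 'rV_n) 0 j]mxE ![(- _ : 'rV_n) 0 j]mxE.
rewrite [delta_mx 0 (f x) 0 b]mxE eqxx andTb (eq_sym b).
set Y := delta_mx 0 (iter _ _ _) 0 j; set X := delta_mx 0 x 0 j.
have -> : - X = - (s ^+ 2 * X) by rewrite ss mul1r.
by ring.
Qed.

(** The vector is supported on the odd iterates of [x]. *)
Lemma walk_vec_eq0 m x v : (forall j, (j < m)%N -> iter j.*2.+1 f x != v) ->
  walk_vec m x 0 v = 0.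
Proof.
elim: m x => [|m IH] x H; first by rewrite mxE.
rewrite !mxE eqxx andTb (eq_sym v) (negPf (H 0%N isT)) mulr0 add0r IH ?mulr0 // => j jm.
by have := H j.+1 jm; rewrite doubleS !iterSr.
Qed.

(** When [v] occurs only as the last odd iterate, its coefficient is a product of entries whose
    squares are 1. *)
Lemma walk_vec_neq0 m x v : (forall z, D z -> S z (f z) ^+ 2 = 1) -> D x ->
  (forall j, (j < m)%N -> iter j.*2.+1 f x != v) -> iter m.*2.+1 f x = v ->
  walk_vec m.+1 x 0 v != 0.
Proof.
move=> sq; have nz z : D z -> S z (f z) != 0.
  by move/sq => E; apply/eqP => Z; move/eqP: E; rewrite Z expr2 mul0r eq_sym oner_eq0.
elim: m x => [|m IH] x Dx H E.
  by rewrite !mxE -E /= !eqxx mulr1 mulr0 addr0 nz.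
rewrite [walk_vec _ _]/=; rewrite mxE [X in X + _]mxE [delta_mx _ _ _ _]mxE.
rewrite eqxx andTb (eq_sym v) (negPf (H 0%N isT)) mulr0 add0r mxE.
rewrite !mulf_neq0 ?nz ?f_D //; apply: IH; [by do 2!apply: f_D| |].
  by move=> j jm; have := H j.+1 jm; rewrite doubleS !iterSr.
by rewrite -!iterSr -doubleS.
Qed.
End CycleVector.

Section CycleRow.
Variables (A S : 'M[F]_n) (c : seq 'I_n) (b : 'I_n) (tau : 'rV[F]_n).
Hypotheses (c_uniq : uniq c) (c_size : (2 < size c)%N) (bc : b \in c).
Hypothesis S_skew : forall x y, S y x = - S x y.
Hypothesis S_sq : forall z, z \in c -> S z (next c z) ^+ 2 = 1.
Hypothesis A_row : forall z, z \in c -> delta_mx 0 z *m A =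
  S z (prev c z) *: delta_mx 0 (prev c z) + S z (next c z) *: delta_mx 0 (next c z) +
  (z == b)%:R *: tau.

Let f := next c.
Let sgn := \prod_(z <- c) S z (next c z).

Let f_c x : x \in c -> f x \in c. Proof. by rewrite mem_next. Qed.

Let A_row' z : z \in c -> delta_mx 0 (f z) *m A =
  - S z (f z) *: delta_mx 0 z + S (f z) (f (f z)) *: delta_mx 0 (f (f z)) +
  (f z == b)%:R *: tau.
Proof. by move=> zc; rewrite A_row ?f_c // prev_next // S_skew. Qed.

Let order_c x : x \in c -> order f x = size c.
Proof.
by move=> xc; have := size_orbit f x; rewrite (orbitE (cycle_next c_uniq)) // size_rot.
Qed.

Let iter_size x : x \in c -> iter (size c) f x = x.
Proof.
by move=> xc; rewrite -(order_c xc); apply: (iter_order_cycle (cycle_next c_uniq)).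
Qed.

Let prod_traject x : x \in c -> \prod_(z <- traject f x (size c)) S z (f z) = sgn.
Proof.
move=> xc; have := orbitE (cycle_next c_uniq) c_uniq xc.
rewrite /orbit order_c // => ->; by apply: perm_big; rewrite perm_rot.
Qed.

Let iter_eq x i : x \in c -> (0 < i < size c)%N -> iter i f x != x.
Proof.
move=> xc /andP[i0 ic]; apply/eqP => E; have := findex_iter (x := x) (f := f).
by move=> /(_ i); rewrite order_c // ic E => /(_ isT); rewrite findex0; lia.
Qed.

Lemma sgn_sq : sgn ^+ 2 = 1.
Proof. by rewrite -prodrXl big_seq big1. Qed.

(** Walk once around the even cycle from [b]. The odd iterates miss [b], so [tau] drops out, and the
    two ends combine to [sgn - 1] times the unit vector at [b]. *)
Lemma cycle_unit_row : ~~ odd (size c) -> sgn != 1 ->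
  exists w : 'rV[F]_n, w *m A = delta_mx 0 b.
Proof.
move=> ev s1; have Em : (size c)./2.*2 = size c by rewrite -[RHS]odd_double_half (negPf ev).
have := walk_vec_mul (D := mem c) f_c (size c)./2 S_sq A_row' bc.
rewrite Em prod_traject // iter_size // walk_vec_eq0 => [|j jm]; last first.
  by apply: iter_eq => //; rewrite -Em; lia.
rewrite scale0r addr0 -{2}[delta_mx 0 b]scale1r -scalerBl => E.
exists ((sgn - 1)^-1 *: walk_vec S f (size c)./2 b).
by rewrite -scalemxAl E scalerA mulVf ?scale1r // subr_eq0.
Qed.

(** Walk around once if the length is even and twice if it is odd, so that the product is 1 and the
    two ends cancel. Starting at [f b] makes [b] the last odd iterate and no earlier one, so its
    coefficient is nonzero. *)
Lemma cycle_kernel_row : odd (size c) \/ sgn = 1 ->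
  exists2 w : 'rV[F]_n, w *m A = w 0 b *: tau & w 0 b != 0.
Proof.
move=> H; pose x := f b; have xc : x \in c := f_c bc.
have [m [m0 Pm Im nm]] : exists m, [/\ (0 < m)%N,
    \prod_(z <- traject f x m.*2) S z (f z) = 1, iter m.*2 f x = x &
    forall j, (j < m.-1)%N -> iter j.*2.+1 f x != b].
  have [od|ev] := boolP (odd (size c)).
    exists (size c); split; first by lia.
    - by rewrite -addnn trajectD big_cat /= iter_size // prod_traject // -expr2 sgn_sq.
    - by rewrite -addnn iterD !iter_size.
    move=> j jm; rewrite -iterSr -doubleS.
    have [jl|jg] := ltnP j.+1.*2 (size c); first by apply: iter_eq => //; lia.
    rewrite -(subnK jg) iterD iter_size //; apply: iter_eq => //.
    by have := odd_double_half (size c); rewrite od; lia.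
  have Em : (size c)./2.*2 = size c by rewrite -[RHS]odd_double_half (negPf ev).
  case: H => [od|s1]; first by rewrite od in ev.
  exists (size c)./2; rewrite Em prod_traject // iter_size //; split=> //; first by lia.
  by move=> j jm; rewrite -iterSr -doubleS; apply: iter_eq => //; lia.
exists (walk_vec S f m x).
  rewrite (walk_vec_mul (D := mem c) f_c m S_sq A_row' xc) Pm Im.
  by rewrite scale1r subrr add0r.
case: m m0 Pm Im nm => // m _ _ Im nm.
apply: (walk_vec_neq0 (D := mem c) f_c) => //.
have inj : injective f := can_inj (prev_next c_uniq).
by apply: inj; rewrite -iterS -doubleS Im.
Qed.

End CycleRow.
End SkewRank.

(** * Oriented graphs *)

Section Oriented.
Variables (n : nat) (arc : rel 'I_n).
Hypothesis arc_or : oriented arc.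
Local Notation G := (underlying arc).
Local Notation S := (skew_adj arc).
Local Notation cyc := (cyc G).
Local Notation nbrs := (nbrs G).
Implicit Types (V : {set 'I_n}) (c : seq 'I_n).

Definition rk V := \rank (mask V S).
Definition good_cycle c := odd (size c) \/ 0 < cycle_sign arc c.

Lemma G_sym : symmetric G. Proof. by move=> x y; rewrite /underlying orbC. Qed.
Lemma G_irr : irreflexive G.
Proof.
by move=> x; rewrite /underlying orbb; apply/negbTE/negP => xx; have := arc_or xx; rewrite xx.
Qed.

Lemma skew_entryN x y : skew_entry arc y x = - skew_entry arc x y.
Proof.
rewrite /skew_entry; case xy: (arc x y); case yx: (arc y x); rewrite ?oppr0 ?opprK //.
by have := arc_or xy; rewrite yx.
Qed.

Lemma skewN x y : S y x = - S x y.
Proof. by rewrite !mxE skew_entryN rmorphN. Qed.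

Lemma skew_tr : S^T = - S.
Proof. by apply/matrixP => i j; rewrite mxE [RHS]mxE skewN. Qed.

Lemma skew0 x y : ~~ G x y -> S x y = 0.
Proof. by rewrite mxE /skew_entry /underlying negb_or => /andP[/negPf-> /negPf->]. Qed.

Lemma skew_sq x y : G x y -> S x y ^+ 2 = 1.
Proof.
rewrite mxE /skew_entry /underlying; case: (arc x y) => /= [_|->].
  by rewrite expr1n.
by rewrite rmorphN sqrrN expr1n.
Qed.

Lemma skew_neq0 x y : G x y -> S x y != 0.
Proof.
move/skew_sq => E; apply/eqP => Z.
by move/eqP: E; rewrite Z expr2 mul0r eq_sym oner_eq0.
Qed.

Lemma row_mask V x : x \in V ->
  delta_mx 0 x *m mask V S = \sum_(z in nbrs V x) S x z *: (delta_mx 0 z : 'rV_n).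
Proof.
move=> xV; apply/rowP => j; rewrite -rowE mxE mxE xV summxE /=.
have [jn|jn] := boolP (j \in nbrs V x).
  have [jV _] := nbrsP _ _ _ _ jn; rewrite jV (bigD1 j) //= !mxE !eqxx mulr1.
  by rewrite big1 ?addr0 // => z /andP[_ zj]; rewrite !mxE eq_sym (negPf zj) mulr0.
rewrite big1 => [|z zn]; last first.
  rewrite mxE [delta_mx _ _ _ _]mxE /=; case: eqP => [E|_]; last by rewrite mulr0.
  by rewrite E zn in jn.
case: ifP => // jV; apply: skew0; apply: contra jn => xj; by rewrite inE jV.
Qed.

Lemma mask_skew V : (mask V S)^T = - mask V S.
Proof. exact/tr_mask/skew_tr. Qed.

Lemma rk_mono V y : (rk (V :\ y) <= rk V)%N.
Proof. exact: mask_rank_mono. Qed.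

Lemma rk_le V y : (rk V <= rk (V :\ y) + 2)%N.
Proof. exact: mask_rank_le. Qed.

Lemma rk_unit V y (w : 'rV_n) : w *m mask V S = delta_mx 0 y ->
  (rk (V :\ y) + 2 <= rk V)%N.
Proof. by move=> wA; rewrite /rk mask_del; apply: rank_kill_unit wA; apply: mask_skew. Qed.

Lemma rk_kernel V x (w : 'rV_n) : w *m mask V S = 0 -> w 0 x != 0 ->
  (rk V <= rk (V :\ x))%N.
Proof.
by move=> wA wx; rewrite /rk mask_del; apply: rank_kill_kernel wA wx; apply: mask_skew.
Qed.

Lemma rk_isolated V x : nbrs V x = set0 -> rk V = rk (V :\ x).
Proof.
move=> nx; rewrite /rk -mask_isolated // => y yV.
have xy : ~~ G x y by apply/negP => xy; have := in_set0 y; rewrite -nx inE yV xy.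
by rewrite [S y x]skewN skew0 // oppr0.
Qed.

(** The row of [x] is a nonzero multiple of the unit vector at [y], so deleting [y] lowers the rank
    by 2; afterwards [x] is isolated. *)
Lemma rk_pendant V x y : x \in V -> nbrs V x = [set y] -> rk V = (rk (V :\ x :\ y) + 2)%N.
Proof.
move=> xV nx; have [yV xy] : y \in V /\ G x y by apply/nbrsP; rewrite nx set11.
have yx : y != x by apply: contraTneq xy => ->; rewrite G_irr.
have E : rk (V :\ y) = rk (V :\ x :\ y).
  rewrite (rk_isolated (V := V :\ y) (x := x)); first by rewrite setDDl setUC -setDDl.
  apply/setP => z; rewrite !inE; apply/negP => /andP[/andP[zy zV] xz].
  by have := in_set1 z y; rewrite -nx inE zV xz (negPf zy).
rewrite -E; apply/eqP; rewrite eqn_leq rk_le /=.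
apply: (@rk_unit V y ((S x y)^-1 *: delta_mx 0 x)).
by rewrite -scalemxAl row_mask // nx big_set1 scalerA mulVf ?scale1r // skew_neq0.
Qed.

Lemma cycle_signE c : uniq c ->
  \prod_(z <- c) S z (next c z) = (cycle_sign arc c)%:~R.
Proof.
move=> u; rewrite /cycle_sign -map_next //.
rewrite (_ : zip c _ = [seq (z, next c z) | z <- c]); last first.
  by elim: (c) (next c) => //= z s IH g; rewrite IH.
by rewrite big_map rmorph_prod; apply: eq_bigr => z _; rewrite mxE.
Qed.

Lemma cyc_sq V c z : cyc V c -> z \in c -> S z (next c z) ^+ 2 = 1.
Proof. by move=> cy zc; apply: skew_sq; case/nbrsP: (cyc_next cy zc). Qed.

(** The product of the entries along a cycle is 1 or -1, so a positive sign means that it equals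
    1. *)
Lemma good_cycleP V c : cyc V c ->
  good_cycle c <-> odd (size c) \/ \prod_(z <- c) S z (next c z) = 1.
Proof.
move=> cy; have u := cyc_uniq cy.
have : (\prod_(z <- c) S z (next c z)) ^+ 2 = 1.
  by apply: sgn_sq => z; apply: cyc_sq cy.
rewrite cycle_signE // /good_cycle => /eqP; rewrite sqrf_eq1 => sq.
split=> -[od|H]; [by left| |by left|]; right.
  case/orP: sq => /eqP // E; have : (0 : rat) < (cycle_sign arc c)%:~R by rewrite ltr0z.
  by rewrite E ltr0N1.
by rewrite -(ltr0z rat) H.
Qed.

Lemma cycle_row V c z : cyc V c -> z \in c -> cycle_nbrs G V c z ->
  delta_mx 0 z *m mask V S = S z (prev c z) *: (delta_mx 0 (prev c z) : 'rV_n) +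
    S z (next c z) *: delta_mx 0 (next c z).
Proof.
move=> cy zc nb; rewrite row_mask ?(cyc_sub cy) // nb big_setU1 ?big_set1 1?addrC //=.
by rewrite inE (cyc_next_neq_prev cy).
Qed.

(** This is the row hypothesis of the cycle vectors, with [tau] the entry of the attaching edge
    times the unit vector at [y]. *)
Lemma pendant_cycle_row V c b y : cyc V c -> b \in c -> y \notin c ->
  nbrs V b = y |: [set next c b; prev c b] ->
  (forall v, v \in c -> v != b -> cycle_nbrs G V c v) ->
  forall z, z \in c -> delta_mx 0 z *m mask V S =
   S z (prev c z) *: (delta_mx 0 (prev c z) : 'rV_n) + S z (next c z) *: delta_mx 0 (next c z)
   + (z == b)%:R *: (S b y *: delta_mx 0 y).
Proof.
move=> cy bc yc nb nbv z zc; have [->|zb] := eqVneq z b; last first.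
  by rewrite scale0r addr0 (cycle_row cy zc) //; apply: nbv.
rewrite scale1r row_mask ?(cyc_sub cy) // nb big_setU1 /=; last first.
  by rewrite !inE; apply: contra yc => /orP[]/eqP->; rewrite ?mem_next ?mem_prev.
rewrite big_setU1 ?big_set1 /=; last by rewrite inE (cyc_next_neq_prev cy).
by rewrite addrC [X in X + _]addrC.
Qed.

Lemma isolated_cycle_row V c b : cyc V c ->
  (forall v, v \in c -> cycle_nbrs G V c v) ->
  forall z, z \in c -> delta_mx 0 z *m mask V S =
   S z (prev c z) *: (delta_mx 0 (prev c z) : 'rV_n) + S z (next c z) *: delta_mx 0 (next c z)
   + (z == b)%:R *: 0.
Proof. by move=> cy nb z zc; rewrite scaler0 addr0 (cycle_row cy zc) //; apply: nb. Qed.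


Lemma rk_set0 : rk set0 = 0%N.
Proof.
rewrite /rk (_ : mask _ _ = 0) ?mxrank0 //.
by apply/matrixP => i j; rewrite !mxE inE.
Qed.

(** Here [tau] is 0: a good cycle carries a kernel vector that is nonzero at [x], while otherwise
    the unit vector at [x] is in the row space and deleting [x] lowers the rank by 2. *)
Lemma rk_isolated_cycle V c x : cyc V c -> (forall v, v \in c -> cycle_nbrs G V c v) ->
  x \in c -> (rk V <= rk (V :\ x))%N <-> good_cycle c.
Proof.
move=> cy nb xc; have rows := isolated_cycle_row x cy nb.
have sz : (2 < size c)%N by case/and3P: cy.
have sq z : z \in c -> S z (next c z) ^+ 2 = 1 by apply: cyc_sq cy.
rewrite (good_cycleP cy); split=> [le|gd]; last first.
  have [w wA wx] := cycle_kernel_row (cyc_uniq cy) sz xc skewN sq rows gd.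
  by apply: rk_kernel wx; rewrite wA scaler0.
have [od|ev] := boolP (odd (size c)); [by left|right].
apply/eqP/negPn/negP => s1.
have [w wA] := cycle_unit_row (cyc_uniq cy) sz xc skewN sq rows ev s1.
by have := leq_trans (rk_unit wA) le; rewrite addn2 ltnNge leqnSn.
Qed.

Section PendantCycle.
Variables (V : {set 'I_n}) (c : seq 'I_n) (b y : 'I_n).
Hypotheses (cy : cyc V c) (bc : b \in c) (yc : y \notin c).
Hypothesis nb : nbrs V b = y |: [set next c b; prev c b].
Hypothesis nbv : forall v, v \in c -> v != b -> cycle_nbrs G V c v.

(** For a good cycle the alternating vector yields a nonzero multiple of the unit vector at [y]. *)
Lemma rk_pendant_cycle : good_cycle c -> (rk (V :\ y) + 2 <= rk V)%N.
Proof.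
have rows := pendant_cycle_row cy bc yc nb nbv.
have sz : (2 < size c)%N by case/and3P: cy.
have sq z : z \in c -> S z (next c z) ^+ 2 = 1 by apply: cyc_sq cy.
have [yV eby] : y \in V /\ G b y by apply/nbrsP; rewrite nb setU11.
move/(good_cycleP cy) => gd.
have [w wA wb] := cycle_kernel_row (cyc_uniq cy) sz bc skewN sq rows gd.
apply: (@rk_unit V y ((w 0 b * S b y)^-1 *: w)).
rewrite -scalemxAl wA [w 0 b *: _]scalerA scalerA mulVf ?scale1r //.
by rewrite mulf_neq0 // skew_neq0.
Qed.

(** Otherwise the unit vector at [b] is in the row space, and deleting [b] would lower the rank by
    2. *)
Lemma rk_pendant_cycle_good : (rk V <= rk (V :\ b))%N -> good_cycle c.
Proof.
have rows := pendant_cycle_row cy bc yc nb nbv.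
have sz : (2 < size c)%N by case/and3P: cy.
have sq z : z \in c -> S z (next c z) ^+ 2 = 1 by apply: cyc_sq cy.
move=> le; apply/(good_cycleP cy).
have [od|ev] := boolP (odd (size c)); [by left|right].
apply/eqP/negPn/negP => s1.
have [w wA] := cycle_unit_row (cyc_uniq cy) sz bc skewN sq rows ev s1.
by have := leq_trans (rk_unit wA) le; rewrite addn2 ltnNge leqnSn.
Qed.
End PendantCycle.
End Oriented.

Theorem theorem1p1 (n : nat) (arc : rel 'I_n) :
  (0 < n)%N ->
  oriented arc ->
  (forall x y : 'I_n, connect (underlying arc) x y) ->
  let G := underlying arc in
  ((skew_rank arc)%:Z + 2 * (indep_num setT G)%:Z >= 2 * n%:Z - 2 * dimcyc G) /\
  ((skew_rank arc)%:Z + 2 * (indep_num setT G)%:Z = 2 * n%:Z - 2 * dimcyc G <->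
     [/\ cycles_vertex_disjoint G,
         cycles_odd_or_evenly_oriented arc &
         (indep_num (TG_vertices G) (TG_adj G))%:Z
           = (indep_num (Gamma_vertices G) G)%:Z + dimcyc G]).
Proof.
move=> n0 arc_or co G.
have G_sym := @G_sym n arc; have G_irr := G_irr arc_or.
have rkE : rk arc setT = skew_rank arc by rewrite /rk mask_setT.
have dE : dimcyc G = (cyclo G setT)%:Z by apply: dimcyc_connected; rewrite ?card_ord.
have cE : #|[set: 'I_n]| = n by rewrite cardsT card_ord.
have ge := skew_rank_ge G_sym G_irr (rk_set0 arc) (@rk_mono n arc)
  (rk_isolated arc_or) (rk_pendant arc_or) setT.
rewrite rkE cE in ge.
(* Given the lower bound [ge], tightness of the whole vertex set is equality; [structured_setT]
   turns the structure into the three conditions, still over natural numbers. *)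
have tE : tight G (rk arc) setT <->
    [/\ cycles_vertex_disjoint G, cycles_odd_or_evenly_oriented arc &
        indep_num (TG_vertices G) (TG_adj G) =
        (indep_num (Gamma_vertices G) G + cyclo G setT)%N].
  rewrite -(structured_setT G_sym G_irr (good_cycle arc)); split.
    apply: tight_structured => //.
    - exact: rk_set0.
    - exact: rk_mono.
    - exact: rk_isolated arc_or.
    - exact: rk_pendant arc_or.
    - exact: rk_isolated_cycle arc_or.
    - exact: rk_pendant_cycle arc_or.
    - exact: rk_pendant_cycle_good arc_or.
  apply: structured_tight => //.
  - exact: rk_set0.
  - exact: rk_le.
  - exact: rk_isolated arc_or.
  - exact: rk_pendant arc_or.
  - exact: rk_isolated_cycle arc_or.
rewrite /tight rkE cE in tE; rewrite dE.
move: ge tE; set a := indep_num setT G; set d := cyclo G setT.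
set t := indep_num (TG_vertices G) _; set g := indep_num (Gamma_vertices G) _.
move=> ge tE; split; first by lia.
split=> [eq|[h1 h2 h3]].
  have [|h1 h2 h3] := tE.1; first by lia.
  by split=> //; lia.
have : (skew_rank arc + 2 * a + 2 * d <= 2 * n)%N by apply/tE; split=> //; lia.
by lia.
Qed.
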